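(* Let $\gamma>0$, $\gamma\neq1$ be constant. Then the set of (complex) ITEs is symmetric with respect to the real axis and contained in a strip $\{|\operatorname{Im}\lambda|\le C(\gamma)\}$ for some $C(\gamma)>0$, and, as $r\to\infty$, \[ N^{\rm alg}_{\mathbb{C}}(r)=(1+\gamma)\frac{r}{\pi}+o(r). \]
   Context: Half-line problem: for $\lambda\in\mathbb{C}\setminus\{0\}$, find $(u,v)$ on $[0,1]$ with $-u''-\lambda^2u=0$, $-v''-\lambda^2\gamma^2v=0$, $u(0)=v(0)=0$, $u(1)=v(1)$, $u'(1)=v'(1)$; $\lambda$ is an ITE if a nontrivial pair exists. ITEs are the nonzero zeros of the entire function $F(\lambda)=\gamma\sin\lambda\cos(\gamma\lambda)-\sin(\gamma\lambda)\cos\lambda$; the algebraic multiplicity of an ITE is its order as a zero of $F$. $N^{\rm alg}_{\mathbb{C}}(r)$ is the number of ITEs $\lambda$ with $\operatorname{Re}\lambda>0$ and $|\lambda|\le r$, counted with algebraic multiplicity. *)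

(* Defs.v *)
From Stdlib Require Import Reals Lra List.
Open Scope R_scope.

Definition Cx : Type := (R * R)%type.
Definition Re (z : Cx) : R := fst z.
Definition Im (z : Cx) : R := snd z.
Definition RtoC (x : R) : Cx := (x, 0).
Definition Cx0 : Cx := (0, 0).
Definition Cadd (z w : Cx) : Cx := (Re z + Re w, Im z + Im w).
Definition Csub (z w : Cx) : Cx := (Re z - Re w, Im z - Im w).
Definition Cmul (z w : Cx) : Cx :=
  (Re z * Re w - Im z * Im w, Re z * Im w + Im z * Re w).
Fixpoint Cpow (z : Cx) (n : nat) : Cx :=
  match n with O => (1, 0) | S k => Cmul z (Cpow z k) end.
Definition Cconj (z : Cx) : Cx := (Re z, - Im z).
Definition Cnorm (z : Cx) : R := sqrt (Re z * Re z + Im z * Im z).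

Definition Csin (z : Cx) : Cx := (sin (Re z) * cosh (Im z), cos (Re z) * sinh (Im z)).
Definition Ccos (z : Cx) : Cx := (cos (Re z) * cosh (Im z), - (sin (Re z) * sinh (Im z))).

Definition Fchar (gamma : R) (l : Cx) : Cx :=
  Csub (Cmul (RtoC gamma) (Cmul (Csin l) (Ccos (Cmul (RtoC gamma) l))))
       (Cmul (Csin (Cmul (RtoC gamma) l)) (Ccos l)).

Definition is_ITE (gamma : R) (l : Cx) : Prop :=
  l <> Cx0 /\ Fchar gamma l = Cx0.

(* Order of a zero: f has order m at z iff f(w)/(w-z)^m tends to a nonzero
   limit L as w -> z (w <> z); written without division. For an entire
   function this is exactly the order of vanishing at z. *)
Definition zero_order (f : Cx -> Cx) (z : Cx) (m : nat) : Prop :=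
  f z = Cx0 /\
  exists L : Cx, L <> Cx0 /\
    forall eps : R, eps > 0 -> exists delta : R, delta > 0 /\
      forall w : Cx, 0 < Cnorm (Csub w z) < delta ->
        Cnorm (Csub (f w) (Cmul L (Cpow (Csub w z) m)))
          <= eps * Cnorm (Csub w z) ^ m.

Definition in_count_region (gamma r : R) (l : Cx) : Prop :=
  is_ITE gamma l /\ Re l > 0 /\ Cnorm l <= r.

Definition N_alg_is (gamma r : R) (n : nat) : Prop :=
  exists L : list (Cx * nat),
    NoDup (map fst L) /\
    (forall l : Cx, in_count_region gamma r l <-> In l (map fst L)) /\
    (forall p : Cx * nat, In p L -> zero_order (Fchar gamma) (fst p) (snd p)) /\
    fold_right Nat.add 0%nat (map snd L) = n.

(* Main.v *)
From Stdlib Require Import Reals Factorial Wf_nat Lra Lia List Classical ClassicalEpsilon.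
From Coquelicot Require Import Coquelicot.
Require Import Defs.
Open Scope R_scope.

(** With [s = 1 + gamma] and [d = gamma - 1] one has
    [F z = (d/2) sin (s z) - (s/2) sin (d z)], and [|d| < s]. Far from the real axis
    [sin (s z)] dominates, so the zeros lie in a strip and [F'/F] tends to [-i s]
    (resp. [i s]) at the top (resp. bottom). No four consecutive derivatives of [F]
    vanish together, so every zero is isolated of finite order. On vertical lines where
    [d sin (s x)] and [sin (d x)] have opposite signs the two terms of [Re F] cannot cancel;
    such lines, with a uniform lower bound for [|F|], occur in every window of some fixed
    length. The argument principle on the rectangle between two of them then gives
    [2 pi N = 2 s (b - a)] up to [eps (b - a)] from the horizontal sides and a
    constant from the vertical ones. *)

(** * Cauchy-Riemann derivatives *)

(** No contour is integrated. For a holomorphic [g], Cauchy-Riemann makes the [x]-derivative of the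
    integral of [Re g] over a vertical segment equal to the difference of [Im g] at its two ends, so
    sliding the segment from [a] to [b] does the work of the rectangle. The obstacle is [g = F'/F]
    when the segment crosses a zero. The polar parts [m / (z - zeta)] are therefore subtracted and
    integrated explicitly: they give arctangents with reciprocal arguments, whose total changes by
    [2 PI] per zero. That the difference extends continuously over the zeros needs [F] expanded one
    term past its leading one. The top side must be high enough for the required [eps], so the
    constant coming from the vertical sides depends on [eps], but not on the position of these
    sides; this is enough for [o(r)]. In general [r] is not a good abscissa and the region is a
    half-disc, so the count is squeezed between rectangles ending at good abscissae a bounded
    distance below and above [r]; the strip keeps that distance bounded. *)

Definition cont_at (f : C -> C) (z : C) : Prop :=
  continuity_2d_pt (fun u v => fst (f (u, v))) (fst z) (snd z) /\
  continuity_2d_pt (fun u v => snd (f (u, v))) (fst z) (snd z).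

(* [f' z] is the complex derivative of [f] at [z] as far as the two coordinate
   directions can tell: the partial derivatives satisfy Cauchy-Riemann. *)
Definition holo_at (f f' : C -> C) (z : C) : Prop :=
  is_derive (fun t => fst (f (t, snd z))) (fst z) (fst (f' z)) /\
  is_derive (fun t => snd (f (t, snd z))) (fst z) (snd (f' z)) /\
  is_derive (fun t => fst (f (fst z, t))) (snd z) (- snd (f' z)) /\
  is_derive (fun t => snd (f (fst z, t))) (snd z) (fst (f' z)).

(** Partial derivatives at a point do not give continuity there, so it is recorded separately. It
    bounds the derivatives locally for the Taylor remainder and allows differentiation under the
    integral sign. *)
Definition derivative_chain (f : nat -> C -> C) : Prop :=
  forall k z, holo_at (f k) (f (S k)) z /\ cont_at (f k) z.

Lemma Cmod_le_abs (z : C) : Cmod z <= Rabs (fst z) + Rabs (snd z).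
Proof.
  replace z with (Cplus (fst z, 0) (0, snd z)) at 1.
  2:{ destruct z as [x y]; unfold Cplus; simpl; f_equal; ring. }
  eapply Rle_trans; [apply Cmod_triangle|].
  right; f_equal; unfold Cmod; simpl.
  - replace (fst z * (fst z * 1) + 0 * (0 * 1)) with (Rsqr (fst z)) by (unfold Rsqr; ring).
    apply sqrt_Rsqr_abs.
  - replace (0 * (0 * 1) + snd z * (snd z * 1)) with (Rsqr (snd z)) by (unfold Rsqr; ring).
    apply sqrt_Rsqr_abs.
Qed.

Lemma abs_fst_le_Cmod (z : C) : Rabs (fst z) <= Cmod z.
Proof. eapply Rle_trans; [apply Rmax_l|apply Rmax_Cmod]. Qed.

Lemma abs_snd_le_Cmod (z : C) : Rabs (snd z) <= Cmod z.
Proof. eapply Rle_trans; [apply Rmax_r|apply Rmax_Cmod]. Qed.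

Lemma Cmod_pos_neq (z : C) : 0 < Cmod z -> z <> 0%C.
Proof. intros H E; subst; rewrite Cmod_0 in H; lra. Qed.

Ltac split4 := split; [|split; [|split]].

Lemma holo_at_const (c z : C) : holo_at (fun _ => c) (fun _ => 0%C) z.
Proof.
  split4; simpl; rewrite ?Ropp_0; apply (is_derive_const (V := R_NormedModule)).
Qed.

Lemma holo_at_id (z : C) : holo_at (fun w => w) (fun _ => 1%C) z.
Proof.
  split4; simpl; auto_derive; trivial; ring.
Qed.

Lemma holo_at_plus (f f' g g' : C -> C) (z : C) :
  holo_at f f' z -> holo_at g g' z ->
  holo_at (fun w => f w + g w)%C (fun w => f' w + g' w)%C z.
Proof.
  intros (A1 & A2 & A3 & A4) (B1 & B2 & B3 & B4); split4; simpl.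
  - apply (is_derive_plus (V := R_NormedModule)); assumption.
  - apply (is_derive_plus (V := R_NormedModule)); assumption.
  - rewrite Ropp_plus_distr; apply (is_derive_plus (V := R_NormedModule)); assumption.
  - apply (is_derive_plus (V := R_NormedModule)); assumption.
Qed.

Lemma is_derive_bilinear_minus (a b c d : R -> R) (x a' b' c' d' : R) :
  is_derive a x a' -> is_derive b x b' -> is_derive c x c' -> is_derive d x d' ->
  is_derive (fun t => a t * c t - b t * d t) x
            (a' * c x + a x * c' - (b' * d x + b x * d')).
Proof.
  intros Ha Hb Hc Hd.
  apply (is_derive_minus (V := R_NormedModule)).
  - apply (is_derive_mult (K := R_AbsRing) a c x a' c' Ha Hc Rmult_comm).
  - apply (is_derive_mult (K := R_AbsRing) b d x b' d' Hb Hd Rmult_comm).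
Qed.

Lemma is_derive_bilinear_plus (a b c d : R -> R) (x a' b' c' d' : R) :
  is_derive a x a' -> is_derive b x b' -> is_derive c x c' -> is_derive d x d' ->
  is_derive (fun t => a t * c t + b t * d t) x
            (a' * c x + a x * c' + (b' * d x + b x * d')).
Proof.
  intros Ha Hb Hc Hd.
  apply (is_derive_plus (V := R_NormedModule)).
  - apply (is_derive_mult (K := R_AbsRing) a c x a' c' Ha Hc Rmult_comm).
  - apply (is_derive_mult (K := R_AbsRing) b d x b' d' Hb Hd Rmult_comm).
Qed.

Lemma holo_at_mult (f f' g g' : C -> C) (z : C) :
  holo_at f f' z -> holo_at g g' z ->
  holo_at (fun w => f w * g w)%C (fun w => f' w * g w + f w * g' w)%C z.
Proof.
  destruct z as [x y].
  intros (A1 & A2 & A3 & A4) (B1 & B2 & B3 & B4); simpl in *; split4; simpl.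
  - evar_last; [apply (is_derive_bilinear_minus _ _ _ _ _ _ _ _ _ A1 A2 B1 B2)|]; simpl; ring.
  - evar_last; [apply (is_derive_bilinear_plus _ _ _ _ _ _ _ _ _ A1 A2 B2 B1)|]; simpl; ring.
  - evar_last; [apply (is_derive_bilinear_minus _ _ _ _ _ _ _ _ _ A3 A4 B3 B4)|]; simpl; ring.
  - evar_last; [apply (is_derive_bilinear_plus _ _ _ _ _ _ _ _ _ A3 A4 B4 B3)|]; simpl; ring.
Qed.

Lemma holo_at_scal (c : C) (f f' : C -> C) (z : C) :
  holo_at f f' z -> holo_at (fun w => c * f w)%C (fun w => c * f' w)%C z.
Proof.
  intros H.
  generalize (holo_at_mult _ _ _ _ _ (holo_at_const c z) H).
  unfold holo_at; simpl.
  intros (A1 & A2 & A3 & A4); split4.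
  all: evar_last; [first [exact A1 | exact A2 | exact A3 | exact A4] | simpl; ring].
Qed.

Lemma holo_at_minus (f f' g g' : C -> C) (z : C) :
  holo_at f f' z -> holo_at g g' z ->
  holo_at (fun w => f w - g w)%C (fun w => f' w - g' w)%C z.
Proof.
  intros Hf Hg.
  generalize (holo_at_plus _ _ _ _ _ Hf (holo_at_scal (-1)%C _ _ _ Hg)).
  unfold holo_at; simpl.
  intros (A1 & A2 & A3 & A4); split4.
  - eapply is_derive_ext; cycle 1; [evar_last; [exact A1|simpl; ring]|intros t; simpl; ring].
  - eapply is_derive_ext; cycle 1; [evar_last; [exact A2|simpl; ring]|intros t; simpl; ring].
  - eapply is_derive_ext; cycle 1; [evar_last; [exact A3|simpl; ring]|intros t; simpl; ring].
  - eapply is_derive_ext; cycle 1; [evar_last; [exact A4|simpl; ring]|intros t; simpl; ring].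
Qed.

Lemma holo_at_shift (f f' : C -> C) (z0 z : C) :
  holo_at f f' (z0 + z)%C ->
  holo_at (fun w => f (z0 + w)%C) (fun w => f' (z0 + w)%C) z.
Proof.
  destruct z0 as [a b], z as [x y].
  assert (Hs : forall u v : R, is_derive (fun t => u + t) v 1).
  { intros; auto_derive; [trivial|ring]. }
  intros (A1 & A2 & A3 & A4); simpl in *; unfold holo_at, Cplus; simpl.
  split4.
  - evar_last; [apply (is_derive_comp (K := R_AbsRing) (V := R_NormedModule) _ _ _ _ _ A1 (Hs a x))| apply (scal_one (V := R_ModuleSpace))].
  - evar_last; [apply (is_derive_comp (K := R_AbsRing) (V := R_NormedModule) _ _ _ _ _ A2 (Hs a x))| apply (scal_one (V := R_ModuleSpace))].
  - evar_last; [apply (is_derive_comp (K := R_AbsRing) (V := R_NormedModule) _ _ _ _ _ A3 (Hs b y))| apply (scal_one (V := R_ModuleSpace))].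
  - evar_last; [apply (is_derive_comp (K := R_AbsRing) (V := R_NormedModule) _ _ _ _ _ A4 (Hs b y))| apply (scal_one (V := R_ModuleSpace))].
Qed.

Lemma holo_at_real_scaling (a : R) (f f' : C -> C) (z : C) :
  holo_at f f' (a * z)%C ->
  holo_at (fun w => f (a * w)%C) (fun w => a * f' (a * w))%C z.
Proof.
  destruct z as [x y].
  assert (E : forall u v : R, (a * (u, v))%C = (a * u, a * v)).
  { intros; unfold Cmult, Complex.RtoC; simpl; f_equal; ring. }
  assert (Hs : forall v : R, is_derive (fun t => a * t) v a).
  { intros; auto_derive; [trivial|ring]. }
  rewrite E.
  intros (A1 & A2 & A3 & A4); simpl in *; unfold holo_at; simpl fst; simpl snd.
  rewrite E.
  split4.
  - eapply is_derive_ext; [intros t; rewrite E; reflexivity|].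
    evar_last; [apply (is_derive_comp (K := R_AbsRing) (V := R_NormedModule) _ _ _ _ _ A1 (Hs x))|].
    simpl; unfold scal; simpl; unfold mult; simpl; ring.
  - eapply is_derive_ext; [intros t; rewrite E; reflexivity|].
    evar_last; [apply (is_derive_comp (K := R_AbsRing) (V := R_NormedModule) _ _ _ _ _ A2 (Hs x))|].
    simpl; unfold scal; simpl; unfold mult; simpl; ring.
  - eapply is_derive_ext; [intros t; rewrite E; reflexivity|].
    evar_last; [apply (is_derive_comp (K := R_AbsRing) (V := R_NormedModule) _ _ _ _ _ A3 (Hs y))|].
    simpl; unfold scal; simpl; unfold mult; simpl; ring.
  - eapply is_derive_ext; [intros t; rewrite E; reflexivity|].
    evar_last; [apply (is_derive_comp (K := R_AbsRing) (V := R_NormedModule) _ _ _ _ _ A4 (Hs y))|].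
    simpl; unfold scal; simpl; unfold mult; simpl; ring.
Qed.

(** * Taylor expansion *)

Lemma is_derive_increment_le (g dg : R -> R) (a b M : R) :
  (forall t, Rmin a b <= t <= Rmax a b -> is_derive g t (dg t)) ->
  (forall t, Rmin a b <= t <= Rmax a b -> Rabs (dg t) <= M) ->
  Rabs (g b - g a) <= M * Rabs (b - a).
Proof.
  intros Hd HM.
  destruct (MVT_gen g a b dg) as [c [Hc Ec]].
  - intros t Ht; apply Hd; lra.
  - intros t Ht; apply derivable_continuous_pt; exists (dg t).
    apply is_derive_Reals; auto.
  - rewrite Ec, Rabs_mult.
    apply Rmult_le_compat_r; [apply Rabs_pos|auto].
Qed.

(* Joining [0] to [w] by a horizontal then a vertical segment, both of which stay
   within distance [|w|] of [0], makes partial derivatives sufficient. *)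
Lemma holo_increment_le (f f' : C -> C) (w : C) (M : R) :
  (forall v, holo_at f f' v) ->
  (forall v, Cmod v <= Cmod w -> Cmod (f' v) <= M) ->
  Cmod (f w - f 0)%C <= 4 * M * Cmod w.
Proof.
  intros Hf HM.
  destruct w as [x y].
  assert (M0 : 0 <= M).
  { eapply Rle_trans; [apply Cmod_ge_0|apply (HM 0%C)].
    rewrite Cmod_0; apply Cmod_ge_0. }
  assert (Hbetween : forall t u, Rmin 0 u <= t <= Rmax 0 u -> t ^ 2 <= u ^ 2).
  { intros t u H; destruct (Rle_dec 0 u) as [h|h].
    - rewrite Rmin_left, Rmax_right in H by lra; nra.
    - rewrite Rmin_right, Rmax_left in H by lra; nra. }
  assert (Hh : forall t, Rmin 0 x <= t <= Rmax 0 x -> Cmod (f' (t, 0)) <= M).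
  { intros t Ht; apply HM; unfold Cmod; apply sqrt_le_1_alt; simpl fst; simpl snd.
    specialize (Hbetween _ _ Ht); nra. }
  assert (Hv : forall t, Rmin 0 y <= t <= Rmax 0 y -> Cmod (f' (x, t)) <= M).
  { intros t Ht; apply HM; unfold Cmod; apply sqrt_le_1_alt; simpl fst; simpl snd.
    specialize (Hbetween _ _ Ht); nra. }
  (* Two components along two segments: four increments, each at most [M * Cmod w], whence the
     factor 4. *)
  assert (B1 : Rabs (fst (f (x, 0)) - fst (f (0, 0))) <= M * Rabs (x - 0)).
  { apply (is_derive_increment_le (fun t => fst (f (t, 0))) (fun t => fst (f' (t, 0)))).
    - intros t _; apply (Hf (t, 0)).
    - intros t Ht; eapply Rle_trans; [apply abs_fst_le_Cmod|auto]. }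
  assert (B2 : Rabs (snd (f (x, 0)) - snd (f (0, 0))) <= M * Rabs (x - 0)).
  { apply (is_derive_increment_le (fun t => snd (f (t, 0))) (fun t => snd (f' (t, 0)))).
    - intros t _; apply (Hf (t, 0)).
    - intros t Ht; eapply Rle_trans; [apply abs_snd_le_Cmod|auto]. }
  assert (B3 : Rabs (fst (f (x, y)) - fst (f (x, 0))) <= M * Rabs (y - 0)).
  { apply (is_derive_increment_le (fun t => fst (f (x, t))) (fun t => - snd (f' (x, t)))).
    - intros t _; apply (Hf (x, t)).
    - intros t Ht; rewrite Rabs_Ropp; eapply Rle_trans; [apply abs_snd_le_Cmod|auto]. }
  assert (B4 : Rabs (snd (f (x, y)) - snd (f (x, 0))) <= M * Rabs (y - 0)).
  { apply (is_derive_increment_le (fun t => snd (f (x, t))) (fun t => fst (f' (x, t)))).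
    - intros t _; apply (Hf (x, t)).
    - intros t Ht; eapply Rle_trans; [apply abs_fst_le_Cmod|auto]. }
  rewrite Rminus_0_r in *.
  eapply Rle_trans; [apply Cmod_le_abs|].
  change (fst (f (x, y) - f 0)%C) with (fst (f (x, y)) + - fst (f (0, 0))).
  change (snd (f (x, y) - f 0)%C) with (snd (f (x, y)) + - snd (f (0, 0))).
  pose proof (abs_fst_le_Cmod (x, y)) as Hx; pose proof (abs_snd_le_Cmod (x, y)) as Hy.
  simpl fst in Hx; simpl snd in Hy.
  assert (T1 := Rabs_triang (fst (f (x, y)) - fst (f (x, 0))) (fst (f (x, 0)) - fst (f (0, 0)))).
  assert (T2 := Rabs_triang (snd (f (x, y)) - snd (f (x, 0))) (snd (f (x, 0)) - snd (f (0, 0)))).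
  replace (fst (f (x, y)) - fst (f (x, 0)) + (fst (f (x, 0)) - fst (f (0, 0))))
    with (fst (f (x, y)) + - fst (f (0, 0))) in T1 by ring.
  replace (snd (f (x, y)) - snd (f (x, 0)) + (snd (f (x, 0)) - snd (f (0, 0))))
    with (snd (f (x, y)) + - snd (f (0, 0))) in T2 by ring.
  assert (M * Rabs x <= M * Cmod (x, y)) by (apply Rmult_le_compat_l; assumption).
  assert (M * Rabs y <= M * Cmod (x, y)) by (apply Rmult_le_compat_l; assumption).
  lra.
Qed.

Fixpoint taylor_poly (f : nat -> C -> C) (z : C) (n : nat) (w : C) : C :=
  match n with
  | O => 0%C
  | S k => (taylor_poly f z k w + (f k z * (/ INR (fact k))%R) * w ^ k)%C
  end.

Lemma holo_at_ext (f g f' g' : C -> C) (z : C) :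
  (forall w, f w = g w) -> f' z = g' z -> holo_at f f' z -> holo_at g g' z.
Proof.
  intros E E' (A1 & A2 & A3 & A4); unfold holo_at; rewrite <- E'.
  split4; eapply is_derive_ext; try eassumption; intros t; simpl; rewrite E; reflexivity.
Qed.

Lemma holo_at_pow (n : nat) (z : C) :
  holo_at (fun w => w ^ S n)%C (fun w => INR (S n) * w ^ n)%C z.
Proof.
  induction n as [|n IH].
  - eapply holo_at_ext; [| |apply holo_at_id].
    + intros w; simpl; ring.
    + simpl; ring.
  - eapply holo_at_ext; [| |apply (holo_at_mult _ _ _ _ _ (holo_at_id z) IH)].
    + intros w; simpl; ring.
    + cbv beta; rewrite (S_INR (S n)), RtoC_plus; simpl Complex.Cpow; ring.
Qed.

(** Differentiating a Taylor polynomial amounts to shifting the sequence of derivatives and dropping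
    one term. This is what makes the remainder estimate inductive. *)
Lemma holo_at_taylor_poly (f : nat -> C -> C) (z : C) (n : nat) (w : C) :
  holo_at (taylor_poly f z (S n)) (taylor_poly (fun k => f (S k)) z n) w.
Proof.
  induction n as [|n IH].
  - eapply holo_at_ext; [| |apply (holo_at_const (f O z) w)].
    + intros v; simpl. replace (/ 1) with 1 by field; ring.
    + reflexivity.
  - eapply holo_at_ext;
      [| |apply (holo_at_plus _ _ _ _ _ IH (holo_at_scal (f (S n) z * (/ INR (fact (S n)))%R)%C _ _ _ (holo_at_pow n w)))].
    + intros v; reflexivity.
    + cbv beta. simpl taylor_poly. f_equal.
      rewrite Cmult_assoc; f_equal. rewrite <- Cmult_assoc; f_equal.
      rewrite <- RtoC_mult; f_equal.
      replace (fact (S n)) with (S n * fact n)%nat by reflexivity.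
      rewrite mult_INR.
      field; split; [apply INR_fact_neq_0| apply not_0_INR; lia].
Qed.

Lemma taylor_poly_0 (f : nat -> C -> C) (z : C) (n : nat) :
  taylor_poly f z (S n) 0 = f O z.
Proof.
  induction n as [|n IH].
  - simpl; replace (/ 1) with 1 by field; ring.
  - change (taylor_poly f z (S (S n)) 0) with
      (taylor_poly f z (S n) 0 + (f (S n) z * (/ INR (fact (S n)))%R)%C * 0 ^ S n)%C.
    rewrite IH; simpl; ring.
Qed.

(** The remainder vanishes at [w = 0] and its derivative is the remainder of the shifted sequence,
    so each induction step costs a factor [4 * Cmod w] through [holo_increment_le]. The constant
    [4 ^ n] is crude, but only the power of [Cmod w] matters later. *)
Lemma taylor_remainder (n : nat) (f : nat -> C -> C) (z : C) (rho M : R) :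
  (forall k v, holo_at (f k) (f (S k)) v) ->
  (forall w, Cmod w <= rho -> Cmod (f n (z + w)%C) <= M) ->
  forall w, Cmod w <= rho ->
    Cmod (f O (z + w) - taylor_poly f z n w)%C <= 4 ^ n * M * Cmod w ^ n.
Proof.
  revert f; induction n as [|n IH]; intros f Hf HM w Hw.
  - simpl; rewrite !Rmult_1_r, Rmult_1_l.
    replace (f O (z + w) - 0)%C with (f O (z + w)%C) by ring; auto.
  - specialize (IH (fun k => f (S k)) (fun k v => Hf (S k) v) HM).
    assert (Hinc := holo_increment_le
      (fun v => f O (z + v) - taylor_poly f z (S n) v)%C
      (fun v => f 1%nat (z + v) - taylor_poly (fun k => f (S k)) z n v)%C w
      (4 ^ n * M * Cmod w ^ n)).
    cbv beta in Hinc; rewrite taylor_poly_0 in Hinc.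
    replace (z + 0)%C with z in Hinc by ring.
    match type of Hinc with _ -> _ -> Cmod ?A <= _ =>
      replace A with (f O (z + w) - taylor_poly f z (S n) w)%C in Hinc by ring end.
    eapply Rle_trans; [apply Hinc|simpl; right; ring].
    + intros v; apply holo_at_minus; [apply holo_at_shift, Hf|apply holo_at_taylor_poly].
    + intros v Hv.
      eapply Rle_trans; [apply IH; lra|].
      apply Rmult_le_compat_l.
      * assert (0 <= M) by (eapply Rle_trans; [apply Cmod_ge_0| apply (HM w Hw)]).
        apply Rmult_le_pos; [apply pow_le; lra|assumption].
      * apply pow_incr; split; [apply Cmod_ge_0|assumption].
Qed.

Lemma cont_at_bounded (f : C -> C) (z : C) :
  cont_at f z ->
  exists rho M, 0 < rho /\ forall w, Cmod w <= rho -> Cmod (f (z + w)%C) <= M.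
Proof.
  destruct z as [x y]; intros [H1 H2].
  destruct (H1 (mkposreal 1 Rlt_0_1)) as [d1 K1], (H2 (mkposreal 1 Rlt_0_1)) as [d2 K2].
  simpl in *.
  exists (Rmin d1 d2 / 2), (Rabs (fst (f (x, y))) + 1 + (Rabs (snd (f (x, y))) + 1)).
  assert (Hd : 0 < Rmin d1 d2) by (apply Rmin_glb_lt; [apply d1|apply d2]).
  split; [lra|].
  intros [u v] Hw.
  assert (Hu := abs_fst_le_Cmod (u, v)); assert (Hv := abs_snd_le_Cmod (u, v)); simpl in Hu, Hv.
  assert (A1 := Rmin_l d1 d2); assert (A2 := Rmin_r d1 d2).
  assert (L1 : Rabs (fst (f (x + u, y + v)) - fst (f (x, y))) < 1).
  { apply K1.
    - replace (x + u - x) with u by ring; lra.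
    - replace (y + v - y) with v by ring; lra. }
  assert (L2 : Rabs (snd (f (x + u, y + v)) - snd (f (x, y))) < 1).
  { apply K2.
    - replace (x + u - x) with u by ring; lra.
    - replace (y + v - y) with v by ring; lra. }
  eapply Rle_trans; [apply Cmod_le_abs|].
  change (((x, y) + (u, v))%C) with (x + u, y + v).
  assert (B1 := Rabs_triang_inv (fst (f (x + u, y + v))) (fst (f (x, y)))).
  assert (B2 := Rabs_triang_inv (snd (f (x + u, y + v))) (snd (f (x, y)))).
  lra.
Qed.

Lemma taylor_poly_first_terms (f : nat -> C -> C) (z : C) (m : nat) (w : C) :
  (forall k, (k < m)%nat -> f k z = 0%C) -> taylor_poly f z m w = 0%C.
Proof.
  induction m as [|m IH]; intros H; [reflexivity|].
  simpl; rewrite IH, (H m) by (intros; try apply H; lia); ring.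
Qed.

(** The second coefficient [L1] is kept because [L1 / L] is the constant term of [f'/f] at [z].
    Multiplying the derivative by [w] gives both estimates the same exponents and avoids
    [w ^ (m - 1)]. *)
Lemma leading_terms (f : nat -> C -> C) (z : C) (m : nat) :
  derivative_chain f ->
  (forall k, (k < m)%nat -> f k z = 0%C) -> f m z <> 0%C ->
  exists (L L1 : C) (rho K : R), L <> 0%C /\ 0 < rho /\ 0 < K /\
    forall w, Cmod w <= rho ->
      Cmod (f O (z + w) - (L * w ^ m + L1 * w ^ S m))%C <= K * Cmod w ^ (m + 2) /\
      Cmod (w * f 1%nat (z + w) - (INR m * L * w ^ m + INR (S m) * L1 * w ^ S m))%C
        <= K * Cmod w ^ (m + 2).
Proof.
  intros Hf Hz Hm.
  set (L := (f m z * (/ INR (fact m))%R)%C); set (L1 := (f (S m) z * (/ INR (fact (S m)))%R)%C).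
  destruct (cont_at_bounded (f (m + 2)%nat) z) as (rho & M & Hrho & HM); [apply Hf|].
  exists L, L1, rho, (4 ^ (m + 2) * Rabs M + 1).
  assert (F0 : forall n, / INR (fact n) <> 0).
  { intros n; apply Rinv_neq_0_compat, INR_fact_neq_0. }
  assert (M0 : 0 <= M).
  { eapply Rle_trans; [apply Cmod_ge_0|apply (HM 0%C)]. rewrite Cmod_0; lra. }
  rewrite (Rabs_pos_eq M) by assumption.
  assert (P4 : forall n, 1 <= 4 ^ n) by (intros; apply pow_R1_Rle; lra).
  split; [|split; [assumption|split]].
  - unfold L; apply Cmult_neq_0; [assumption|].
    intros E; apply (F0 m); apply RtoC_inj; exact E.
  - assert (0 <= 4 ^ (m + 2) * M) by (apply Rmult_le_pos; [specialize (P4 (m+2)%nat); lra|assumption]); lra.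
  - intros w Hw.
    assert (Hpow : 0 <= Cmod w ^ (m + 2)) by (apply pow_le, Cmod_ge_0).
    assert (T0 := taylor_remainder (m + 2) f z rho M (fun k v => proj1 (Hf k v)) HM w Hw).
    split.
    + replace (L * w ^ m + L1 * w ^ S m)%C with (taylor_poly f z (m + 2) w).
      * eapply Rle_trans; [apply T0|nra].
      * replace (m + 2)%nat with (S (S m)) by lia.
        simpl taylor_poly; rewrite taylor_poly_first_terms by assumption.
        unfold L, L1; simpl; ring.
    + assert (T1 := taylor_remainder (m + 1) (fun k => f (S k)) z rho M
                      (fun k v => proj1 (Hf (S k) v))).
      cbv beta in T1.
      replace (S (m + 1)) with (m + 2)%nat in T1 by lia.
      specialize (T1 HM w Hw).
      replace (w * f 1%nat (z + w) - (INR m * L * w ^ m + INR (S m) * L1 * w ^ S m))%C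
        with (w * (f 1%nat (z + w) - taylor_poly (fun k => f (S k)) z (m + 1) w))%C.
      * rewrite Cmod_mult.
        apply Rle_trans with (Cmod w * (4 ^ (m + 1) * M * Cmod w ^ (m + 1))).
        { apply Rmult_le_compat_l; [apply Cmod_ge_0|assumption]. }
        replace (m + 2)%nat with (S (m + 1)) by lia.
        replace (m + 2)%nat with (S (m + 1)) in Hpow by lia.
        simpl in Hpow |- *.
        set (p := Cmod w * Cmod w ^ (m + 1)) in *.
        replace (Cmod w * (4 ^ (m + 1) * M * Cmod w ^ (m + 1))) with (4 ^ (m + 1) * M * p)
          by (unfold p; ring).
        assert (0 <= 4 ^ (m + 1) * M * p).
        { apply Rmult_le_pos; [|assumption]. apply Rmult_le_pos; [|assumption].
          specialize (P4 (m+1)%nat); lra. }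
        nra.
      * transitivity (w * f 1%nat (z + w) - w * taylor_poly (fun k => f (S k)) z (m + 1) w)%C; [ring|].
        f_equal.
        replace (m + 1)%nat with (S m) by lia.
        assert (Hrec : forall n, INR (S n) * / INR (fact (S n)) = / INR (fact n)).
        { intros n; replace (fact (S n)) with (S n * fact n)%nat by reflexivity.
          rewrite mult_INR; field; split; [apply INR_fact_neq_0| apply not_0_INR; lia]. }
        simpl taylor_poly.
        assert (E1 : (INR (S m) * L1 = f (S m) z * (/ INR (fact m))%R)%C).
        { unfold L1; rewrite <- (Hrec m), RtoC_mult; ring. }
        rewrite E1.
        (* For [m = 0] the derivative has no term of degree [m - 1]; the coefficient [INR m] is then
           zero. *)
        destruct m as [|m'].
        { simpl taylor_poly; simpl INR; simpl Complex.Cpow; ring. }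
        simpl taylor_poly.
        rewrite taylor_poly_first_terms by (intros; apply Hz; lia).
        assert (E0 : (INR (S m') * L = f (S m') z * (/ INR (fact m'))%R)%C).
        { unfold L; rewrite <- (Hrec m'), RtoC_mult; ring. }
        rewrite E0; simpl Complex.Cpow; ring.
Qed.

(** * Orders of zeros and finiteness *)

(** Here [m] is the residue of [f'/f] at [z] and [c] the constant term of its Laurent expansion. The
    value [c] is recorded because it fills the singularity once the pole is removed. *)
Definition log_derivative_residue (f f' : C -> C) (z : C) (m : nat) (c : C) : Prop :=
  forall eps, 0 < eps -> exists delta, 0 < delta /\ forall w, 0 < Cmod w < delta ->
    Cmod (f' (z + w) / f (z + w) - INR m / w - c)%C <= eps.

Lemma Cmod_minus_ge (a b : C) : Cmod a - Cmod b <= Cmod (a - b)%C.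
Proof.
  assert (H := Cmod_triangle (a - b) b).
  replace (a - b + b)%C with a in H by ring; lra.
Qed.

Lemma leading_term_lower (f : C -> C) (L L1 : C) (m : nat) (z : C) (rho K : R) :
  L <> 0%C -> 0 < rho -> 0 < K ->
  (forall w, Cmod w <= rho ->
      Cmod (f (z + w) - (L * w ^ m + L1 * w ^ S m))%C <= K * Cmod w ^ (m + 2)) ->
  exists delta, 0 < delta <= rho /\ delta <= 1 /\ forall w, Cmod w < delta ->
    Cmod (f (z + w) - L * w ^ m)%C <= (Cmod L1 + K) * Cmod w ^ S m /\
    Cmod L / 2 * Cmod w ^ m <= Cmod (f (z + w)%C).
Proof.
  intros HL Hrho HK H.
  assert (L0 : 0 < Cmod L) by (apply Cmod_gt_0; exact HL).
  set (B := Cmod L1 + K).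
  assert (HB : 0 < B) by (unfold B; assert (T := Cmod_ge_0 L1); lra).
  assert (Hq : 0 < Cmod L / (2 * B)) by (apply Rdiv_lt_0_compat; lra).
  (* Radius at most 1 absorbs the power [m + 2] into [S m]; the last bound makes the total error at
     most half of the leading term. *)
  exists (Rmin (Rmin 1 rho) (Cmod L / (2 * B))).
  assert (A1 := Rmin_l (Rmin 1 rho) (Cmod L / (2 * B))).
  assert (A2 := Rmin_r (Rmin 1 rho) (Cmod L / (2 * B))).
  assert (A3 := Rmin_l 1 rho). assert (A4 := Rmin_r 1 rho).
  split; [split; [repeat apply Rmin_glb_lt; lra|lra]|split; [lra|]].
  intros w Hw.
  assert (W0 := Cmod_ge_0 w).
  assert (P : 0 <= Cmod w ^ m) by (apply pow_le; lra).
  assert (E : Cmod (f (z + w) - L * w ^ m)%C <= B * Cmod w ^ S m).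
  { replace (f (z + w) - L * w ^ m)%C
      with ((f (z + w) - (L * w ^ m + L1 * w ^ S m)) + L1 * w ^ S m)%C by ring.
    eapply Rle_trans; [apply Cmod_triangle|].
    assert (H1 : Cmod w <= rho) by lra.
    specialize (H w H1).
    rewrite Cmod_mult, Cmod_pow.
    replace (m + 2)%nat with (S (S m)) in H by lia.
    simpl in H |- *; unfold B.
    assert (Cmod w * (Cmod w * Cmod w ^ m) <= 1 * (Cmod w * Cmod w ^ m)).
    { apply Rmult_le_compat_r; [apply Rmult_le_pos; assumption|lra]. }
    nra. }
  split; [exact E|].
  assert (T := Cmod_minus_ge (L * w ^ m)%C (L * w ^ m - f (z + w))%C).
  replace (L * w ^ m - (L * w ^ m - f (z + w)))%C with (f (z + w)%C) in T by ring.
  replace (L * w ^ m - f (z + w))%C with (- (f (z + w) - L * w ^ m))%C in T by ring.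
  rewrite Cmod_opp, Cmod_mult, Cmod_pow in T.
  assert (B * Cmod w <= Cmod L / 2).
  { replace (Cmod L / 2) with (B * (Cmod L / (2 * B))) by (field; lra).
    apply Rmult_le_compat_l; lra. }
  simpl in E.
  assert (B * Cmod w * Cmod w ^ m <= Cmod L / 2 * Cmod w ^ m) by (apply Rmult_le_compat_r; assumption).
  nra.
Qed.

Lemma Cnorm_Cmod (z : C) : Cnorm z = Cmod z.
Proof. unfold Cnorm, Cmod, Re, Im; f_equal; ring. Qed.

Lemma Cpow_eq (z : C) (n : nat) : Defs.Cpow z n = (z ^ n)%C.
Proof. induction n as [|n IH]; [reflexivity|]. simpl; rewrite <- IH; reflexivity. Qed.

Lemma zero_order_of_leading_terms (f : C -> C) (L L1 : C) (m : nat) (z : C) (rho K : R) :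
  L <> 0%C -> 0 < rho -> 0 < K -> f z = 0%C ->
  (forall w, Cmod w <= rho ->
      Cmod (f (z + w) - (L * w ^ m + L1 * w ^ S m))%C <= K * Cmod w ^ (m + 2)) ->
  zero_order f z m.
Proof.
  intros HL Hrho HK Hz H.
  destruct (leading_term_lower f L L1 m z rho K HL Hrho HK H) as (d & Hd & Hd1 & Hb).
  split; [exact Hz|].
  exists L; split; [exact HL|].
  intros eps He.
  set (B := Cmod L1 + K).
  assert (HB : 0 < B) by (unfold B; assert (T := Cmod_ge_0 L1); lra).
  exists (Rmin d (eps / B)).
  assert (0 < eps / B) by (apply Rdiv_lt_0_compat; lra).
  split; [apply Rmin_glb_lt; lra|].
  intros w Hw.
  assert (A1 := Rmin_l d (eps / B)); assert (A2 := Rmin_r d (eps / B)).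
  change (Csub w z) with (w - z)%C in *.
  rewrite Cpow_eq, !Cnorm_Cmod in *.
  destruct (Hb (w - z)%C) as [E _]; [lra|].
  assert (E0 : (z + (w - z) = w :> C)%C) by ring.
  rewrite E0 in E.
  eapply Rle_trans; [exact E|].
  fold B; simpl; rewrite <- Rmult_assoc.
  apply Rmult_le_compat_r; [apply pow_le; lra|].
  replace eps with (B * (eps / B)) by (field; lra).
  apply Rmult_le_compat_l; lra.
Qed.

(** If [m' > m], the second expansion makes [f] of size at most a constant times [t ^ m'] at
    distance [t], too small to match [L * t ^ m] with [L] nonzero. *)
Lemma zero_order_le (f : C -> C) (z : C) (m m' : nat) :
  zero_order f z m -> zero_order f z m' -> (m' <= m)%nat.
Proof.
  intros (_ & L & HL & H) (_ & L' & _ & H').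
  destruct (Nat.le_gt_cases m' m) as [h|h]; [exact h|exfalso].
  assert (L0 : 0 < Cmod L) by (apply Cmod_gt_0; exact HL).
  destruct (H (Cmod L / 4)) as (d & Hd & Hb); [lra|].
  destruct (H' 1) as (d' & Hd' & Hb'); [lra|].
  set (B := Cmod L' + 1).
  assert (HB : 0 < B) by (unfold B; assert (T := Cmod_ge_0 L'); lra).
  (* One real increment serves both expansions. Halving gives strict inequalities, and
     [B * t <= Cmod L / 4] leaves room for the other error [Cmod L / 4 * t ^ m]. *)
  set (t := Rmin (Rmin d d') (Rmin 1 (Cmod L / (4 * B))) / 2).
  assert (Hq : 0 < Cmod L / (4 * B)) by (apply Rdiv_lt_0_compat; lra).
  assert (A1 := Rmin_l (Rmin d d') (Rmin 1 (Cmod L / (4 * B)))).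
  assert (A2 := Rmin_r (Rmin d d') (Rmin 1 (Cmod L / (4 * B)))).
  assert (A3 := Rmin_l d d'). assert (A4 := Rmin_r d d').
  assert (A5 := Rmin_l 1 (Cmod L / (4 * B))). assert (A6 := Rmin_r 1 (Cmod L / (4 * B))).
  assert (Ht : 0 < t).
  { unfold t; apply Rdiv_lt_0_compat; [repeat apply Rmin_glb_lt; lra|lra]. }
  assert (Ht2 : t < Rmin (Rmin d d') (Rmin 1 (Cmod L / (4 * B)))) by (unfold t in *; lra).
  clearbody t.
  assert (Em : Cmod (t : C) = t) by (rewrite Cmod_R; apply Rabs_pos_eq; lra).
  assert (Ew : Csub (z + t)%C z = (t : C)).
  { change (z + t - z = t :> C)%C; ring. }
  specialize (Hb (z + t)%C); specialize (Hb' (z + t)%C).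
  rewrite Ew, Cpow_eq, !Cnorm_Cmod, Em in *.
  specialize (Hb ltac:(lra)); specialize (Hb' ltac:(lra)).
  change (Csub (f (z + t)%C) (Cmul L (t ^ m)%C)) with (f (z + t) - L * t ^ m)%C in Hb.
  change (Csub (f (z + t)%C) (Cmul L' (t ^ m')%C)) with (f (z + t) - L' * t ^ m')%C in Hb'.
  assert (T := Cmod_triangle (L * t ^ m - f (z + t))%C (f (z + t) - L' * t ^ m')%C).
  assert (T2 := Cmod_triangle (L * t ^ m - f (z + t) + (f (z + t) - L' * t ^ m'))%C (L' * t ^ m')%C).
  replace (L * t ^ m - f (z + t) + (f (z + t) - L' * t ^ m') + L' * t ^ m')%C with (L * t ^ m)%C in T2 by ring.
  replace (L * t ^ m - f (z + t))%C with (- (f (z + t) - L * t ^ m))%C in T by ring.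
  rewrite Cmod_opp in T.
  replace (L * t ^ m - f (z + t))%C with (- (f (z + t) - L * t ^ m))%C in T2 by ring.
  rewrite !Cmod_mult, !Cmod_pow, Em in T2.
  assert (P : 0 < t ^ m) by (apply pow_lt; lra).
  assert (Q : t ^ m' <= t * t ^ m).
  { replace m' with (S m + (m' - S m))%nat by lia.
    rewrite pow_add; simpl.
    rewrite <- (Rmult_1_r (t * t ^ m)) at 2.
    apply Rmult_le_compat_l; [nra|].
    rewrite <- (pow1 (m' - S m)); apply pow_incr; lra. }
  assert (R1 : B * t ^ m' <= B * t * t ^ m).
  { rewrite Rmult_assoc; apply Rmult_le_compat_l; lra. }
  assert (R2 : B * t <= Cmod L / 4).
  { replace (Cmod L / 4) with (B * (Cmod L / (4 * B))) by (field; lra).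
    apply Rmult_le_compat_l; lra. }
  assert (R3 : B * t * t ^ m <= Cmod L / 4 * t ^ m) by (apply Rmult_le_compat_r; lra).
  unfold B in *; nra.
Qed.

(** Any list may witness [N_alg_is]; uniqueness identifies the orders it carries with the
    multiplicities [mu] used in the count. *)
Lemma zero_order_unique (f : C -> C) (z : C) (m m' : nat) :
  zero_order f z m -> zero_order f z m' -> m = m'.
Proof.
  intros H H'; apply Nat.le_antisymm; eapply zero_order_le; eassumption.
Qed.

Lemma log_derivative_residue_of_leading_terms
    (f f' : C -> C) (L L1 : C) (m : nat) (z : C) (rho K : R) :
  L <> 0%C -> 0 < rho -> 0 < K ->
  (forall w, Cmod w <= rho ->
      Cmod (f (z + w) - (L * w ^ m + L1 * w ^ S m))%C <= K * Cmod w ^ (m + 2) /\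
      Cmod (w * f' (z + w) - (INR m * L * w ^ m + INR (S m) * L1 * w ^ S m))%C
        <= K * Cmod w ^ (m + 2)) ->
  log_derivative_residue f f' z m (L1 / L)%C.
Proof.
  intros HL Hrho HK H.
  destruct (leading_term_lower f L L1 m z rho K HL Hrho HK (fun w h => proj1 (H w h)))
    as (d & Hd & Hd1 & Hb).
  assert (L0 : 0 < Cmod L) by (apply Cmod_gt_0; exact HL).
  set (B := Cmod L1 + K) in *.
  assert (HB : 0 < B) by (unfold B; assert (T := Cmod_ge_0 L1); lra).
  assert (Hm : 0 <= INR m) by apply pos_INR.
  set (c := (L1 / L)%C).
  set (A := (K + INR m * K + Cmod c * B) * (2 / Cmod L)).
  assert (HA : 0 < A).
  { unfold A; apply Rmult_lt_0_compat; [|apply Rdiv_lt_0_compat; lra].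
    assert (0 <= Cmod c * B) by (apply Rmult_le_pos; [apply Cmod_ge_0|lra]).
    nra. }
  intros eps He.
  assert (0 < eps / A) by (apply Rdiv_lt_0_compat; lra).
  exists (Rmin d (eps / A)).
  split; [apply Rmin_glb_lt; lra|].
  intros w Hw.
  assert (A1 := Rmin_l d (eps / A)); assert (A2 := Rmin_r d (eps / A)).
  destruct (Hb w) as [E1 E2]; [lra|].
  destruct (H w) as [G1 G2]; [lra|].
  assert (W0 : 0 < Cmod w) by lra.
  assert (Wn : w <> 0%C) by (apply Cmod_pos_neq; lra).
  assert (P : 0 < Cmod w ^ m) by (apply pow_lt; lra).
  assert (Fn : f (z + w)%C <> 0%C).
  { apply Cmod_pos_neq. assert (0 < Cmod L / 2 * Cmod w ^ m) by (apply Rmult_lt_0_compat; lra); lra. }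
  set (Fz := f (z + w)%C) in *; set (Gz := f' (z + w)%C) in *.
  (* Numerator of the difference over the common denominator [w * Fz], written as three error terms
     of order [m + 2]. The terms in [w ^ S m] cancel precisely because [c * L = L1]. As the
     denominator has order [m + 1], the quotient is [O(w)]. *)
  set (N := ((w * Gz - (INR m * L * w ^ m + INR (S m) * L1 * w ^ S m))
            - INR m * (Fz - (L * w ^ m + L1 * w ^ S m))
            - c * w * (Fz - L * w ^ m))%C).
  assert (EN : (Gz / Fz - INR m / w - c = N / (w * Fz))%C).
  { unfold N, c; rewrite S_INR, RtoC_plus; simpl Complex.Cpow; field; auto. }
  rewrite EN, Cmod_div by (apply Cmult_neq_0; assumption).
  rewrite Cmod_mult.
  assert (BN : Cmod N <= (K + INR m * K + Cmod c * B) * Cmod w ^ (m + 2)).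
  { unfold N.
    assert (T1 := Cmod_triangle (w * Gz - (INR m * L * w ^ m + INR (S m) * L1 * w ^ S m)
            - INR m * (Fz - (L * w ^ m + L1 * w ^ S m))) (- (c * w * (Fz - L * w ^ m)))).
    assert (T2 := Cmod_triangle (w * Gz - (INR m * L * w ^ m + INR (S m) * L1 * w ^ S m))
            (- (INR m * (Fz - (L * w ^ m + L1 * w ^ S m))))).
    rewrite Cmod_opp, !Cmod_mult, Cmod_R, Rabs_pos_eq in T2 by assumption.
    rewrite Cmod_opp, !Cmod_mult in T1.
    assert (INR m * Cmod (Fz - (L * w ^ m + L1 * w ^ S m))%C <= INR m * (K * Cmod w ^ (m + 2)))
      by (apply Rmult_le_compat_l; assumption).
    assert (Cmod c * Cmod w * Cmod (Fz - L * w ^ m)%C <= Cmod c * Cmod w * (B * Cmod w ^ S m)).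
    { apply Rmult_le_compat_l; [apply Rmult_le_pos; [apply Cmod_ge_0|lra]|assumption]. }
    replace (Cmod c * Cmod w * (B * Cmod w ^ S m)) with (Cmod c * B * Cmod w ^ (m + 2)) in *
      by (replace (m + 2)%nat with (S (S m)) by lia; simpl; ring).
    unfold Cminus in *. lra. }
  apply Rle_trans with (A * Cmod w).
  - apply Rle_div_l; [apply Rmult_lt_0_compat; [lra|]; apply Cmod_gt_0; exact Fn|].
    eapply Rle_trans; [exact BN|].
    apply Rle_trans with (A * Cmod w * (Cmod w * (Cmod L / 2 * Cmod w ^ m))).
    + right; unfold A; replace (m + 2)%nat with (S (S m)) by lia; simpl; field; lra.
    + apply Rmult_le_compat_l; [apply Rmult_le_pos; lra|].
      apply Rmult_le_compat_l; lra.
  - replace eps with (A * (eps / A)) by (field; lra).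
    apply Rmult_le_compat_l; lra.
Qed.

Lemma first_nonvanishing (f : nat -> C -> C) (z : C) :
  (exists k, f k z <> 0%C) ->
  exists m, f m z <> 0%C /\ forall k, (k < m)%nat -> f k z = 0%C.
Proof.
  intros Hk.
  destruct (dec_inh_nat_subset_has_unique_least_element
              (fun k => f k z <> 0%C) (fun n => classic _) Hk) as (m & [Hm Hmin] & _).
  exists m; split; [exact Hm|].
  intros k Hkm; destruct (classic (f k z = 0%C)) as [e|e]; [exact e|].
  specialize (Hmin k e); lia.
Qed.

Lemma isolated_of_chain (f : nat -> C -> C) (z : C) :
  derivative_chain f -> (exists k, f k z <> 0%C) ->
  exists delta, 0 < delta /\ forall w, 0 < Cmod w < delta -> f O (z + w)%C <> 0%C.
Proof.
  intros Hf Hk.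
  destruct (first_nonvanishing f z Hk) as (m & Hm & Hmin).
  destruct (leading_terms f z m Hf Hmin Hm) as (L & L1 & rho & K & HL & Hrho & HK & H).
  destruct (leading_term_lower (f O) L L1 m z rho K HL Hrho HK (fun w h => proj1 (H w h)))
    as (d & Hd & _ & Hb).
  exists d; split; [lra|]; intros w Hw.
  destruct (Hb w) as [_ E]; [lra|].
  apply Cmod_pos_neq.
  assert (0 < Cmod L) by (apply Cmod_gt_0; exact HL).
  assert (0 < Cmod L / 2 * Cmod w ^ m).
  { apply Rmult_lt_0_compat; [lra|apply pow_lt; lra]. }
  lra.
Qed.

Lemma zero_multiplicity_exists (f : nat -> C -> C) (z : C) :
  derivative_chain f -> (exists k, f k z <> 0%C) -> f O z = 0%C ->
  exists m c, zero_order (f O) z m /\ log_derivative_residue (f O) (f 1%nat) z m c.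
Proof.
  intros Hf Hk Hz.
  destruct (first_nonvanishing f z Hk) as (m & Hm & Hmin).
  destruct (leading_terms f z m Hf Hmin Hm) as (L & L1 & rho & K & HL & Hrho & HK & H).
  exists m, (L1 / L)%C; split.
  - apply (zero_order_of_leading_terms (f O) L L1 m z rho K HL Hrho HK Hz).
    intros w Hw; apply H; exact Hw.
  - apply (log_derivative_residue_of_leading_terms _ _ L L1 m z rho K HL Hrho HK H).
Qed.

(** A closed square of side [h] holds at most one point of [P], so stacking [n] squares leaves
    finitely many. For [n = 0] the column is a horizontal segment of length [h]. *)
Lemma separated_column (P : R -> R -> Prop) (x c h : R) (n : nat) :
  (forall u v u' v', P u v -> P u' v' -> Rabs (u' - u) <= h -> Rabs (v' - v) <= h ->
     u' = u /\ v' = v) ->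
  exists l : list C, forall u v, x <= u <= x + h -> c <= v <= c + INR n * h -> P u v -> In (u, v) l.
Proof.
  intros Hs; induction n as [|n [l Hl]].
  - destruct (classic (exists u, x <= u <= x + h /\ P u c)) as [[u0 [Hu0 HP0]]|Hno].
    + exists ((u0, c) :: nil); intros u v Hu Hv HP.
      assert (v = c) by (simpl in Hv; lra); subst v.
      destruct (Hs u0 c u c HP0 HP) as [-> _].
      * apply Rabs_le; lra.
      * apply Rabs_le; lra.
      * left; reflexivity.
    + exists nil; intros u v Hu Hv HP.
      assert (v = c) by (simpl in Hv; lra); subst v.
      exfalso; apply Hno; exists u; auto.
  - rewrite S_INR.
    destruct (classic (exists u v, x <= u <= x + h /\ c + INR n * h <= v <= c + INR n * h + h /\ P u v))
      as [(u0 & v0 & Hu0 & Hv0 & HP0)|Hno].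
    + exists ((u0, v0) :: l); intros u v Hu Hv HP.
      destruct (Rle_dec v (c + INR n * h)) as [hv|hv]; [right; apply Hl; auto; lra|left].
      destruct (Hs u0 v0 u v HP0 HP) as [-> ->]; [apply Rabs_le; lra|apply Rabs_le; lra|reflexivity].
    + exists l; intros u v Hu Hv HP.
      destruct (Rle_dec v (c + INR n * h)) as [hv|hv]; [apply Hl; auto; lra|].
      exfalso; apply Hno; exists u, v; repeat split; auto; lra.
Qed.

Lemma separated_box (P : R -> R -> Prop) (a c h : R) (m n : nat) :
  (forall u v u' v', P u v -> P u' v' -> Rabs (u' - u) <= h -> Rabs (v' - v) <= h ->
     u' = u /\ v' = v) ->
  exists l : list C, forall u v, a <= u <= a + INR (S m) * h -> c <= v <= c + INR n * h ->
    P u v -> In (u, v) l.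
Proof.
  intros Hs; induction m as [|m [l Hl]].
  - destruct (separated_column P a c h n Hs) as [l Hl]; exists l.
    intros u v Hu Hv; apply Hl; auto; simpl in Hu; lra.
  - destruct (separated_column P (a + INR (S m) * h) c h n Hs) as [l' Hl'].
    exists (l ++ l'); intros u v Hu Hv HP; apply in_or_app.
    destruct (Rle_dec u (a + INR (S m) * h)) as [hu|hu]; [left; apply Hl; auto; lra|right].
    apply Hl'; auto. rewrite S_INR in Hu; lra.
Qed.

(** Compactness turns the isolation radii, which vary with the point, into one spacing [h]: two
    points of [P] within [h / 2] of each other in both coordinates lie in the box of a common
    centre, and both must equal that centre. *)
Lemma finitely_many_isolated (P : C -> Prop) (a b c d : R) :
  (forall z, exists delta, 0 < delta /\ forall w, 0 < Cmod w < delta -> ~ P (z + w)%C) ->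
  exists l : list C, forall z, a <= fst z <= b -> c <= snd z <= d -> P z -> In z l.
Proof.
  intros Hiso.
  assert (Hiso' : forall u v, exists delta : posreal,
     forall u' v', Rabs (u' - u) < 2 * delta -> Rabs (v' - v) < 2 * delta -> P (u', v') ->
       u' = u /\ v' = v).
  { intros u v; destruct (Hiso (u, v)) as (e & He & H).
    assert (He4 : 0 < e / 4) by lra.
    (* With [delta = e / 4] the box of half-side [2 * delta] lies in the disc of radius [e]. The
       factor 2 makes room for a second point near one that is [delta]-close to the centre. *)
    exists (mkposreal _ He4); simpl; intros u' v' Hu Hv HP.
    destruct (classic ((u', v') = (u, v))) as [E|N]; [inversion E; auto|].
    exfalso; apply (H ((u' - u)%R, (v' - v)%R)).
    - split.
      + apply Cmod_gt_0; intros E; apply N; inversion E; f_equal; lra.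
      + eapply Rle_lt_trans; [apply Cmod_le_abs|simpl; lra].
    - replace ((u, v) + ((u' - u)%R, (v' - v)%R))%C with (u', v'); [exact HP|].
      unfold Cplus; simpl; f_equal; ring. }
  assert (Hdelta : exists delta : R -> R -> posreal, forall u v u' v',
     Rabs (u' - u) < 2 * delta u v -> Rabs (v' - v) < 2 * delta u v -> P (u', v') ->
       u' = u /\ v' = v).
  { exists (fun u v => proj1_sig (constructive_indefinite_description _ (Hiso' u v))).
    intros u v; apply (proj2_sig (constructive_indefinite_description _ (Hiso' u v))). }
  destruct Hdelta as [delta Hdelta].
  destruct (compactness_value_2d a b c d delta) as [h Hh].
  assert (h0 := cond_pos h).
  set (Q := fun u v => a <= u <= b /\ c <= v <= d /\ P (u, v)).
  assert (Hs : forall u v u' v', Q u v -> Q u' v' -> Rabs (u' - u) <= h / 2 ->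
     Rabs (v' - v) <= h / 2 -> u' = u /\ v' = v).
  { intros u v u' v' (Hu & Hv & HP) (_ & _ & HP') Du Dv.
    apply NNPP; intros N; apply (Hh u v Hu Hv); intros (s & t & _ & _ & Hs & Ht & Hd).
    apply N.
    destruct (Hdelta s t u v) as [-> ->]; [lra|lra|exact HP|].
    apply (Hdelta s t); [lra|lra|exact HP']. }
  destruct (INR_unbounded (Rabs (b - a) / (h / 2))) as [m Hm].
  destruct (INR_unbounded (Rabs (d - c) / (h / 2))) as [n Hn].
  destruct (separated_box Q a c (h / 2) m n Hs) as [l Hl].
  exists l; intros [u v] Hu Hv HP; simpl in Hu, Hv; apply Hl; [| |split; auto].
  - apply Rlt_div_l in Hm; [|lra]. rewrite S_INR. assert (T := Rle_abs (b - a)); lra.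
  - apply Rlt_div_l in Hn; [|lra]. assert (T := Rle_abs (d - c)); lra.
Qed.

(** * Quotients and vertical integrals *)

Lemma cont_at_plus (f g : C -> C) (z : C) :
  cont_at f z -> cont_at g z -> cont_at (fun w => f w + g w)%C z.
Proof. intros [A1 A2] [B1 B2]; split; simpl; apply continuity_2d_pt_plus; assumption. Qed.

Lemma cont_at_const (c z : C) : cont_at (fun _ => c) z.
Proof. split; apply continuity_2d_pt_const. Qed.

Lemma cont_at_id (z : C) : cont_at (fun w => w) z.
Proof. split; simpl; [apply continuity_2d_pt_id1|apply continuity_2d_pt_id2]. Qed.

Lemma cont_at_mult (f g : C -> C) (z : C) :
  cont_at f z -> cont_at g z -> cont_at (fun w => f w * g w)%C z.
Proof.
  intros [A1 A2] [B1 B2]; split; simpl.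
  - apply continuity_2d_pt_minus; apply continuity_2d_pt_mult; assumption.
  - apply continuity_2d_pt_plus; apply continuity_2d_pt_mult; assumption.
Qed.

Lemma cont_at_ext (f g : C -> C) (z : C) :
  (forall w, f w = g w) -> cont_at f z -> cont_at g z.
Proof.
  intros E [A1 A2]; split.
  - apply continuity_2d_pt_ext with (2 := A1); intros u v; rewrite E; reflexivity.
  - apply continuity_2d_pt_ext with (2 := A2); intros u v; rewrite E; reflexivity.
Qed.

Lemma cont_at_minus (f g : C -> C) (z : C) :
  cont_at f z -> cont_at g z -> cont_at (fun w => f w - g w)%C z.
Proof.
  intros Hf Hg.
  apply cont_at_ext with (fun w => f w + (-1) * g w)%C; [intros w; ring|].
  apply cont_at_plus; [exact Hf|apply cont_at_mult; [apply cont_at_const|exact Hg]].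
Qed.

Lemma sum_sqr_neq_0 (z : C) : z <> 0%C -> fst z ^ 2 + snd z ^ 2 <> 0.
Proof.
  intros Hz E; apply Hz; destruct z as [x y]; simpl in E.
  assert (x = 0) by nra; assert (y = 0) by nra; subst; reflexivity.
Qed.

Lemma cont_at_inv (f : C -> C) (z : C) :
  cont_at f z -> f z <> 0%C -> cont_at (fun w => / f w)%C z.
Proof.
  destruct z as [x y]; intros [A1 A2] Hn; simpl in *.
  assert (D : continuity_2d_pt (fun u v => / (fst (f (u, v)) ^ 2 + snd (f (u, v)) ^ 2)) x y).
  { apply continuity_2d_pt_inv.
    - simpl; apply continuity_2d_pt_plus; apply continuity_2d_pt_mult; try assumption;
        apply continuity_2d_pt_mult; try assumption; apply continuity_2d_pt_const.
    - apply sum_sqr_neq_0; exact Hn. }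
  split; simpl.
  - apply continuity_2d_pt_mult; assumption.
  - apply continuity_2d_pt_mult; [apply continuity_2d_pt_opp|]; assumption.
Qed.

Lemma cont_at_of_modulus (f : C -> C) (z : C) :
  (forall eps, 0 < eps -> exists delta, 0 < delta /\ forall w, Cmod w < delta ->
     Cmod (f (z + w) - f z)%C <= eps) -> cont_at f z.
Proof.
  destruct z as [x y]; intros H.
  assert (K : forall eps : posreal, exists delta : posreal, forall u v,
     Rabs (u - x) < delta -> Rabs (v - y) < delta -> Cmod (f (u, v) - f (x, y))%C < eps).
  { intros eps; assert (e0 := cond_pos eps).
    destruct (H (eps / 2)) as (d & Hd & Hb); [lra|].
    assert (Hd2 : 0 < d / 2) by lra.
    exists (mkposreal _ Hd2); simpl; intros u v Hu Hv.
    specialize (Hb ((u - x)%R, (v - y)%R)).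
    assert (E : (((x, y) + ((u - x)%R, (v - y)%R))%C = (u, v) :> C)).
    { unfold Cplus; simpl; f_equal; ring. }
    rewrite E in Hb.
    eapply Rle_lt_trans; [apply Hb|lra].
    eapply Rle_lt_trans; [apply Cmod_le_abs|simpl; lra]. }
  split; intros eps; destruct (K eps) as [d Hd]; exists d; simpl; intros u v Hu Hv;
    (eapply Rle_lt_trans; [|apply (Hd u v Hu Hv)]).
  - apply (abs_fst_le_Cmod (f (u, v) - f (x, y))%C).
  - apply (abs_snd_le_Cmod (f (u, v) - f (x, y))%C).
Qed.

Lemma is_derive_inv_parts (a b : R -> R) (x a' b' : R) :
  is_derive a x a' -> is_derive b x b' -> a x ^ 2 + b x ^ 2 <> 0 ->
  is_derive (fun t => a t / (a t ^ 2 + b t ^ 2)) x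
    ((a' * (b x ^ 2 - a x ^ 2) - 2 * a x * b x * b') / (a x ^ 2 + b x ^ 2) ^ 2) /\
  is_derive (fun t => - b t / (a t ^ 2 + b t ^ 2)) x
    ((2 * a x * b x * a' - b' * (a x ^ 2 - b x ^ 2)) / (a x ^ 2 + b x ^ 2) ^ 2).
Proof.
  intros Ha Hb Hn.
  assert (Da : Derive (fun t => a t) x = a') by (apply is_derive_unique, Ha).
  assert (Db : Derive (fun t => b t) x = b') by (apply is_derive_unique, Hb).
  assert (Ea : ex_derive a x) by (eexists; eassumption).
  assert (Eb : ex_derive b x) by (eexists; eassumption).
  split; auto_derive; try (repeat split; assumption);
    rewrite ?Da, ?Db; field; exact Hn.
Qed.

Lemma holo_at_inv (f f' : C -> C) (z : C) :
  holo_at f f' z -> f z <> 0%C ->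
  holo_at (fun w => / f w)%C (fun w => - (f' w * (/ f w * / f w)))%C z.
Proof.
  destruct z as [x y]; intros (A1 & A2 & A3 & A4) Hn.
  apply sum_sqr_neq_0 in Hn; simpl fst in *; simpl snd in *.
  assert (Hn' : fst (f (x, y)) * fst (f (x, y)) + snd (f (x, y)) * snd (f (x, y)) <> 0).
  { intros E; apply Hn; rewrite <- E; ring. }
  destruct (is_derive_inv_parts _ _ _ _ _ A1 A2 Hn) as [B1 B2].
  destruct (is_derive_inv_parts _ _ _ _ _ A3 A4 Hn) as [B3 B4].
  split4; simpl fst; simpl snd.
  - evar_last; [exact B1|]; field; auto.
  - evar_last; [exact B2|]; field; auto.
  - evar_last; [exact B3|]; field; auto.
  - evar_last; [exact B4|]; field; auto.
Qed.

(** Continuity of the derivative is included because differentiating a vertical integral under the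
    integral sign requires it. *)
Definition holo_on (D : C -> Prop) (f : C -> C) : Prop :=
  exists f', forall z, D z -> holo_at f f' z /\ cont_at f z /\ cont_at f' z.

Lemma holo_on_const (D : C -> Prop) (c : C) : holo_on D (fun _ => c).
Proof.
  exists (fun _ => 0%C); intros z _; split; [apply holo_at_const|split; apply cont_at_const].
Qed.

Lemma holo_on_minus (D : C -> Prop) (f g : C -> C) :
  holo_on D f -> holo_on D g -> holo_on D (fun w => f w - g w)%C.
Proof.
  intros [f' Hf] [g' Hg]; exists (fun w => f' w - g' w)%C; intros z Hz.
  destruct (Hf z Hz) as (A & B & E), (Hg z Hz) as (A' & B' & E').
  split; [apply holo_at_minus; assumption|split; apply cont_at_minus; assumption].
Qed.

Lemma holo_on_plus (D : C -> Prop) (f g : C -> C) :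
  holo_on D f -> holo_on D g -> holo_on D (fun w => f w + g w)%C.
Proof.
  intros [f' Hf] [g' Hg]; exists (fun w => f' w + g' w)%C; intros z Hz.
  destruct (Hf z Hz) as (A & B & E), (Hg z Hz) as (A' & B' & E').
  split; [apply holo_at_plus; assumption|split; apply cont_at_plus; assumption].
Qed.

Lemma holo_on_div (D : C -> Prop) (f g : C -> C) :
  holo_on D f -> holo_on D g -> (forall z, D z -> g z <> 0%C) ->
  holo_on D (fun w => f w / g w)%C.
Proof.
  intros [f' Hf] [g' Hg] Hn.
  exists (fun w => f' w * / g w + f w * - (g' w * (/ g w * / g w)))%C; intros z Hz.
  destruct (Hf z Hz) as (A & B & E), (Hg z Hz) as (A' & B' & E').
  specialize (Hn z Hz).
  assert (I := cont_at_inv g z B' Hn).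
  split; [|split].
  - apply holo_at_mult; [exact A|apply holo_at_inv; assumption].
  - apply cont_at_mult; assumption.
  - apply cont_at_plus; apply cont_at_mult; try assumption.
    apply cont_at_ext with (fun w => 0 - g' w * (/ g w * / g w))%C; [intros w; ring|].
    apply cont_at_minus; [apply cont_at_const|].
    apply cont_at_mult; [assumption|apply cont_at_mult; assumption].
Qed.

Lemma cont_at_line (f : C -> C) (x y : R) :
  cont_at f (x, y) ->
  continuous (fun t => fst (f (x, t))) y /\ continuous (fun t => snd (f (x, t))) y.
Proof.
  intros [A1 A2]; split; apply continuity_pt_filterlim; intros eps He.
  - destruct (A1 (mkposreal eps He)) as [d Hd]; exists d; split; [apply d|].
    intros t [_ Ht]; apply Hd; simpl; [rewrite Rminus_diag, Rabs_R0; apply d|exact Ht].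
  - destruct (A2 (mkposreal eps He)) as [d Hd]; exists d; split; [apply d|].
    intros t [_ Ht]; apply Hd; simpl; [rewrite Rminus_diag, Rabs_R0; apply d|exact Ht].
Qed.

Lemma ex_RInt_line (f : C -> C) (x Y : R) :
  0 < Y -> (forall y, - Y <= y <= Y -> cont_at f (x, y)) ->
  ex_RInt (fun y => fst (f (x, y))) (- Y) Y.
Proof.
  intros HY Hc; apply (ex_RInt_continuous (V := R_CompleteNormedModule)).
  rewrite Rmin_left, Rmax_right by lra.
  intros y Hy; apply (cont_at_line f x y (Hc y Hy)).
Qed.

(** Under the integral sign [Re g] becomes [Re g'], which by Cauchy-Riemann is the [y]-derivative of
    [Im g]; the integral then telescopes to the two ends. *)
Lemma vertical_integral_derive (g : C -> C) (x delta Y : R) :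
  0 < delta -> 0 < Y -> holo_on (fun z => Rabs (fst z - x) < delta) g ->
  is_derive (fun t => RInt (fun y => fst (g (t, y))) (- Y) Y) x
            (snd (g (x, Y)) - snd (g (x, - Y))).
Proof.
  intros Hd HY [g' Hg].
  assert (Hx : forall y : R, Rabs (fst (x, y) - x) < delta).
  { intros y; simpl; rewrite Rminus_diag, Rabs_R0; exact Hd. }
  evar_last.
  - apply (is_derive_RInt_param (fun u v => fst (g (u, v)))).
    + exists (mkposreal _ Hd); intros u Hu t _.
      exists (fst (g' (u, t))); apply (Hg (u, t)); exact Hu.
    + intros t _.
      eapply continuity_2d_pt_ext_loc; [|apply (proj1 (proj2 (proj2 (Hg (x, t) (Hx t)))))].
      exists (mkposreal _ Hd); simpl; intros u v Hu _.
      symmetry; apply is_derive_unique, (Hg (u, v)); exact Hu.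
    + exists (mkposreal _ Hd); intros u Hu.
      apply ex_RInt_line; [exact HY|]; intros y _; apply (Hg (u, y)); exact Hu.
  - transitivity (RInt (fun t => fst (g' (x, t))) (- Y) Y).
    { apply RInt_ext; intros t _; apply is_derive_unique, (Hg (x, t)), Hx. }
    apply is_RInt_unique.
    apply (is_RInt_derive (V := R_CompleteNormedModule) (fun t => snd (g (x, t)))).
    + intros t _; apply (Hg (x, t)), Hx.
    + intros t _; apply cont_at_line, (Hg (x, t)), Hx.
Qed.

(** A mean value inequality that ignores the derivative at finitely many points: the interval is cut
    at each of them and continuity glues the pieces. The points will be the abscissae of the
    zeros. *)
Lemma mean_value_off_finite (l : list R) (f : R -> R) (kappa E a b : R) :
  a <= b -> 0 <= E ->
  (forall eps, 0 < eps -> exists delta, 0 < delta /\ forall x u,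
     a <= x <= b -> a <= u <= b -> Rabs (u - x) < delta -> Rabs (f u - f x) < eps) ->
  (forall x, a < x < b -> ~ In x l -> exists d, is_derive f x d /\ Rabs (d - kappa) <= E) ->
  Rabs (f b - f a - kappa * (b - a)) <= E * (b - a).
Proof.
  revert a b; induction l as [|x0 l IH]; intros a b Hab HE Hc Hd.
  - destruct Hab as [Hab|Hab].
    2:{ subst b; rewrite !Rminus_diag, !Rmult_0_r, Rminus_0_r, Rabs_R0; lra. }
    apply le_epsilon; intros eps0 He0.
    assert (K0 := Rabs_pos kappa).
    (* The derivative is controlled only inside the interval, which is shrunk by [eta <= eps] at
       each end. The two end increments of [f] cost [eps] each and the lost term [2 * kappa * eta]
       at most [2 * Rabs kappa * eps], in total [eps0]. *)
    set (eps := eps0 / (2 + 2 * Rabs kappa)).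
    assert (He : 0 < eps) by (apply Rdiv_lt_0_compat; lra).
    destruct (Hc eps He) as (delta & Hdelta & Hu).
    set (eta := Rmin eps (Rmin delta (b - a)) / 3).
    assert (A1 := Rmin_l eps (Rmin delta (b - a))); assert (A2 := Rmin_r eps (Rmin delta (b - a))).
    assert (A3 := Rmin_l delta (b - a)); assert (A4 := Rmin_r delta (b - a)).
    assert (Heta : 0 < eta).
    { apply Rdiv_lt_0_compat; [repeat apply Rmin_glb_lt; lra|lra]. }
    assert (Heta3 : 3 * eta <= Rmin eps (Rmin delta (b - a))) by (unfold eta; lra).
    clearbody eta.
    assert (D : forall x, a < x < b -> is_derive f x (Derive f x) /\ Rabs (Derive f x - kappa) <= E).
    { intros x Hx; destruct (Hd x Hx) as (d & H1 & H2); [intros []|].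
      rewrite (is_derive_unique _ _ _ H1); auto. }
    assert (M := is_derive_increment_le (fun t => f t - kappa * t) (fun t => Derive f t - kappa)
                   (a + eta) (b - eta) E).
    rewrite Rmin_left, Rmax_right in M by lra.
    assert (M1 : Rabs (f (b - eta) - kappa * (b - eta) - (f (a + eta) - kappa * (a + eta)))
                  <= E * Rabs (b - eta - (a + eta))).
    { apply M; intros t Ht.
      - apply (is_derive_minus (V := R_NormedModule)); [apply D; lra|].
        auto_derive; [trivial|ring].
      - apply D; lra. }
    rewrite (Rabs_pos_eq (b - eta - (a + eta))) in M1 by lra.
    assert (U1 : Rabs (f (a + eta) - f a) < eps).
    { apply Hu; try lra. replace (a + eta - a) with eta by ring; rewrite Rabs_pos_eq; lra. }
    assert (U2 : Rabs (f (b - eta) - f b) < eps).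
    { apply Hu; try lra. replace (b - eta - b) with (- eta) by ring; rewrite Rabs_Ropp, Rabs_pos_eq; lra. }
    assert (Hk : Rabs (2 * kappa * eta) <= 2 * Rabs kappa * eps).
    { rewrite !Rabs_mult, (Rabs_pos_eq 2), (Rabs_pos_eq eta) by lra.
      apply Rmult_le_compat_l; lra. }
    assert (HEE : E * (b - eta - (a + eta)) <= E * (b - a)) by (apply Rmult_le_compat_l; lra).
    assert (Heps : eps0 = 2 * eps + 2 * Rabs kappa * eps) by (unfold eps; field; lra).
    replace (f b - f a - kappa * (b - a)) with
      ((f (b - eta) - kappa * (b - eta) - (f (a + eta) - kappa * (a + eta)))
       + (f (a + eta) - f a) - (f (b - eta) - f b) - 2 * kappa * eta) by ring.
    assert (T1 := Rabs_triang ((f (b - eta) - kappa * (b - eta) - (f (a + eta) - kappa * (a + eta)))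
       + (f (a + eta) - f a) - (f (b - eta) - f b)) (- (2 * kappa * eta))).
    assert (T2 := Rabs_triang ((f (b - eta) - kappa * (b - eta) - (f (a + eta) - kappa * (a + eta)))
       + (f (a + eta) - f a)) (- (f (b - eta) - f b))).
    assert (T3 := Rabs_triang (f (b - eta) - kappa * (b - eta) - (f (a + eta) - kappa * (a + eta)))
       (f (a + eta) - f a)).
    rewrite Rabs_Ropp in T1, T2. unfold Rminus in *. lra.
  - destruct (Rlt_dec a x0) as [h1|h1]; [destruct (Rlt_dec x0 b) as [h2|h2]|].
    + assert (L : Rabs (f x0 - f a - kappa * (x0 - a)) <= E * (x0 - a)).
      { apply IH; [lra|assumption| |].
        - intros eps He; destruct (Hc eps He) as (d & Hdp & H); exists d; split; [exact Hdp|].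
          intros; apply H; lra.
        - intros x Hx Hn; apply Hd; [lra|]; intros [e|e]; [lra|auto]. }
      assert (U : Rabs (f b - f x0 - kappa * (b - x0)) <= E * (b - x0)).
      { apply IH; [lra|assumption| |].
        - intros eps He; destruct (Hc eps He) as (d & Hdp & H); exists d; split; [exact Hdp|].
          intros; apply H; lra.
        - intros x Hx Hn; apply Hd; [lra|]; intros [e|e]; [lra|auto]. }
      replace (f b - f a - kappa * (b - a)) with
        ((f b - f x0 - kappa * (b - x0)) + (f x0 - f a - kappa * (x0 - a))) by ring.
      eapply Rle_trans; [apply Rabs_triang|]; lra.
    + apply IH; try assumption.
      intros x Hx Hn; apply Hd; [lra|]; intros [e|e]; [lra|auto].
    + apply IH; try assumption.
      intros x Hx Hn; apply Hd; [lra|]; intros [e|e]; [lra|auto].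
Qed.

(** * The argument principle *)

Fixpoint csum (l : list C) (g : C -> C) : C :=
  match l with nil => 0%C | zeta :: l' => (g zeta + csum l' g)%C end.

Fixpoint rsum (l : list C) (g : C -> R) : R :=
  match l with nil => 0 | zeta :: l' => g zeta + rsum l' g end.

Definition total_multiplicity (mu : C -> nat) (l : list C) : nat :=
  fold_right Nat.add 0%nat (map mu l).

Lemma csum_app_middle (l1 l2 : list C) (zeta : C) (g : C -> C) :
  csum (l1 ++ zeta :: l2) g = (g zeta + csum (l1 ++ l2) g)%C.
Proof. induction l1 as [|a l1 IH]; simpl; [reflexivity|rewrite IH; ring]. Qed.

(* Since [/ 0 = 0], the value [- c] at [zeta] is what makes
   [f'/f - polar_part m c zeta] continuous there when [c] is the constant term of
   [f'/f] at [zeta]. *)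
Definition polar_part (m : nat) (c zeta z : C) : C :=
  (INR m / (z - zeta) - (if excluded_middle_informative (z = zeta) then c else 0))%C.

Definition regularised (f f' : C -> C) (l : list C) (mu : C -> nat) (c : C -> C) (z : C) : C :=
  (f' z / f z - csum l (fun zeta => polar_part (mu zeta) (c zeta) zeta z))%C.

Lemma polar_part_off (m : nat) (c zeta z : C) :
  z <> zeta -> polar_part m c zeta z = (INR m / (z - zeta))%C.
Proof.
  intros H; unfold polar_part; destruct (excluded_middle_informative (z = zeta)); [contradiction|ring].
Qed.

Lemma Cinv_zero : (/ 0)%C = 0%C.
Proof. unfold Cinv, Complex.RtoC; simpl; f_equal; unfold Rdiv; ring. Qed.

Lemma cont_at_simple_pole (m : nat) (zeta z : C) :
  z <> zeta -> cont_at (fun w => INR m / (w - zeta))%C z.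
Proof.
  intros H; apply cont_at_mult; [apply cont_at_const|].
  apply cont_at_inv; [apply cont_at_minus; [apply cont_at_id|apply cont_at_const]|].
  intros E; apply H. replace z with ((z - zeta) + zeta)%C by ring; rewrite E; ring.
Qed.

Lemma cont_at_ext_near (f g : C -> C) (z : C) (delta : R) :
  0 < delta -> (forall w, Cmod (w - z)%C < delta -> f w = g w) -> cont_at f z -> cont_at g z.
Proof.
  destruct z as [x y]; intros Hd E [A1 A2].
  assert (Hd2 : 0 < delta / 2) by lra.
  assert (E' : forall u v, Rabs (u - x) < delta / 2 -> Rabs (v - y) < delta / 2 -> f (u, v) = g (u, v)).
  { intros u v Hu Hv; apply E; eapply Rle_lt_trans; [apply Cmod_le_abs|].
    change (Rabs (u - x) + Rabs (v - y) < delta); lra. }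
  split; (eapply continuity_2d_pt_ext_loc; [exists (mkposreal _ Hd2)|]); simpl.
  - intros u v Hu Hv; rewrite <- E' by assumption; reflexivity.
  - exact A1.
  - intros u v Hu Hv; rewrite <- E' by assumption; reflexivity.
  - exact A2.
Qed.

Lemma cont_at_polar_part (m : nat) (c zeta z : C) :
  z <> zeta -> cont_at (polar_part m c zeta) z.
Proof.
  intros H.
  assert (Hp : 0 < Cmod (z - zeta)%C).
  { apply Cmod_gt_0; intros E; apply H.
    replace z with ((z - zeta) + zeta)%C by ring; rewrite E; ring. }
  apply cont_at_ext_near with (fun w => INR m / (w - zeta))%C (Cmod (z - zeta)%C);
    [exact Hp| |apply cont_at_simple_pole; exact H].
  intros w Hw; symmetry; apply polar_part_off; intros ->.
  replace (zeta - z)%C with (- (z - zeta))%C in Hw by ring.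
  rewrite Cmod_opp in Hw; lra.
Qed.

Lemma cont_at_csum (l : list C) (g : C -> C -> C) (z : C) :
  (forall zeta, In zeta l -> cont_at (g zeta) z) ->
  cont_at (fun w => csum l (fun zeta => g zeta w)) z.
Proof.
  induction l as [|a l IH]; intros H; simpl.
  - apply cont_at_const.
  - apply cont_at_plus; [apply H; left; reflexivity|apply IH; intros; apply H; right; assumption].
Qed.

Lemma cont_at_regularised_off (f f' : C -> C) l mu c z :
  cont_at f z -> cont_at f' z -> f z <> 0%C -> ~ In z l ->
  cont_at (regularised f f' l mu c) z.
Proof.
  intros Hf Hf' Hz Hn; apply cont_at_minus.
  - apply cont_at_mult; [exact Hf'|apply cont_at_inv; assumption].
  - apply (cont_at_csum l (fun zeta => polar_part (mu zeta) (c zeta) zeta)).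
    intros zeta Hi; apply cont_at_polar_part; intros ->; contradiction.
Qed.

(** As [l] has no repetition, exactly one polar part is centred at [z]. Paired with [f'/f] it leaves
    the limit [c z], which is also the value prescribed at [z]; the other polar parts are continuous
    there. *)
Lemma cont_at_regularised_zero (f f' : C -> C) l mu c z :
  NoDup l -> In z l -> f z = 0%C -> log_derivative_residue f f' z (mu z) (c z) ->
  cont_at (regularised f f' l mu c) z.
Proof.
  intros Hl Hi Hz Hres.
  destruct (in_split z l Hi) as (l1 & l2 & ->).
  apply NoDup_remove_2 in Hl.
  apply cont_at_ext with (fun w => (f' w / f w - polar_part (mu z) (c z) z w)
     - csum (l1 ++ l2) (fun zeta => polar_part (mu zeta) (c zeta) zeta w))%C.
  { intros w; unfold regularised; rewrite csum_app_middle; ring. }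
  apply cont_at_minus.
  2:{ apply (cont_at_csum _ (fun zeta => polar_part (mu zeta) (c zeta) zeta)).
      intros zeta Hzeta; apply cont_at_polar_part; intros ->; contradiction. }
  apply cont_at_of_modulus; intros eps He.
  destruct (Hres eps He) as (d & Hd & Hb).
  exists d; split; [exact Hd|]; intros w Hw.
  assert (Ez : (f' z / f z - polar_part (mu z) (c z) z z = c z)%C).
  { unfold polar_part; destruct (excluded_middle_informative (z = z)) as [_|n]; [|contradiction].
    rewrite Hz; replace (z - z)%C with (Complex.RtoC 0) by ring.
    unfold Cdiv; rewrite Cinv_zero; ring. }
  rewrite Ez.
  destruct (classic (w = 0%C)) as [->|Hw0].
  - replace (z + 0)%C with z by ring; rewrite Ez.
    replace (c z - c z)%C with (Complex.RtoC 0) by ring; rewrite Cmod_0; lra.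
  - rewrite polar_part_off.
    + replace (z + w - z)%C with w by ring.
      apply Hb; split; [apply Cmod_gt_0; exact Hw0|exact Hw].
    + intros E; apply Hw0; replace w with ((z + w) - z)%C by ring; rewrite E; ring.
Qed.

Lemma away_from_finite (l : list R) (x : R) :
  ~ In x l -> exists delta, 0 < delta /\ forall u, Rabs (u - x) < delta -> ~ In u l.
Proof.
  induction l as [|a l IH]; intros H.
  - exists 1; split; [lra|intros u _ []].
  - destruct IH as (d & Hd & Hu); [intros h; apply H; right; exact h|].
    assert (Ha : 0 < Rabs (a - x)).
    { apply Rabs_pos_lt; intros E; apply H; left; lra. }
    exists (Rmin d (Rabs (a - x))); split; [apply Rmin_glb_lt; assumption|].
    intros u Hux [->|Hin].
    + assert (T := Rmin_r d (Rabs (u - x))); lra.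
    + apply (Hu u); [assert (T := Rmin_l d (Rabs (a - x))); lra|exact Hin].
Qed.

Lemma holo_on_csum (D : C -> Prop) (l : list C) (g : C -> C -> C) :
  (forall zeta, In zeta l -> holo_on D (g zeta)) ->
  holo_on D (fun w => csum l (fun zeta => g zeta w)).
Proof.
  induction l as [|a l IH]; intros H; simpl.
  - apply holo_on_const.
  - apply (holo_on_plus D (g a)); [apply H; left; reflexivity|apply IH; intros; apply H; right; assumption].
Qed.

Lemma csum_ext (l : list C) (g h : C -> C) :
  (forall zeta, In zeta l -> g zeta = h zeta) -> csum l g = csum l h.
Proof.
  induction l as [|a l IH]; intros H; simpl; [reflexivity|].
  rewrite (H a (or_introl eq_refl)), IH; [reflexivity|intros; apply H; right; assumption].
Qed.

Lemma simple_pole_parts (m : nat) (x y xi eta : R) :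
  (INR m / ((x, y) - (xi, eta)))%C =
  (INR m * ((x - xi) / ((x - xi) ^ 2 + (y - eta) ^ 2)),
   INR m * (- (y - eta) / ((x - xi) ^ 2 + (y - eta) ^ 2))).
Proof.
  unfold Cdiv, Cmult, Cinv, Cminus, Cplus, Copp, Complex.RtoC; simpl.
  unfold Rminus; f_equal; ring.
Qed.

(** Antiderivative in [x] of the imaginary part of [mu zeta / (z - zeta)] on the bottom side minus
    that on the top side. *)
Definition horizontal_angle (mu : C -> nat) (Y x : R) (zeta : C) : R :=
  INR (mu zeta) * (atan ((x - fst zeta) / (Y - snd zeta)) + atan ((x - fst zeta) / (Y + snd zeta))).

(** The signed angle under which the segment of abscissa [x] between heights [-Y] and [Y] is seen
    from [zeta], with multiplicity; it is the integral of the real part of the pole along that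
    segment. *)
Definition vertical_angle (mu : C -> nat) (Y x : R) (zeta : C) : R :=
  INR (mu zeta) * (atan ((Y - snd zeta) / (x - fst zeta)) + atan ((Y + snd zeta) / (x - fst zeta))).

Lemma is_derive_horizontal_angle (mu : C -> nat) (Y x : R) (l : list C) :
  (forall zeta, In zeta l -> - Y < snd zeta < Y) ->
  is_derive (fun t => rsum l (horizontal_angle mu Y t)) x
    (snd (csum l (fun zeta => INR (mu zeta) / ((x, (- Y)%R) - zeta))%C)
     - snd (csum l (fun zeta => INR (mu zeta) / ((x, Y) - zeta))%C)).
Proof.
  induction l as [|[xi eta] l IH]; intros H.
  - simpl; auto_derive; trivial; ring.
  - assert (Hy : - Y < eta < Y) by (apply (H (xi, eta)); left; reflexivity).
    evar_last.
    + apply (is_derive_plus (V := R_NormedModule) (fun t => horizontal_angle mu Y t (xi, eta))).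
      * unfold horizontal_angle; simpl fst; simpl snd.
        auto_derive; [repeat split; lra|reflexivity].
      * apply IH; intros; apply H; right; assumption.
    + simpl csum. rewrite !simple_pole_parts.
      unfold plus; simpl.
      assert (D1 : (x - xi) ^ 2 + (Y - eta) ^ 2 <> 0).
      { assert (0 < (Y - eta) ^ 2) by (apply pow_lt; lra). assert (0 <= (x - xi) ^ 2) by apply pow2_ge_0; lra. }
      assert (D2 : (x - xi) ^ 2 + (- Y - eta) ^ 2 <> 0).
      { replace ((- Y - eta) ^ 2) with ((Y + eta) ^ 2) by ring.
        assert (0 < (Y + eta) ^ 2) by (apply pow_lt; lra). assert (0 <= (x - xi) ^ 2) by apply pow2_ge_0; lra. }
      simpl in D1, D2.
      field.
      repeat split; try assumption; try lra;
        intros E; first [apply D2; rewrite <- E; ring | apply D1; rewrite <- E; ring].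
Qed.

Lemma is_RInt_vertical_angle (mu : C -> nat) (Y x : R) (l : list C) :
  0 < Y -> (forall zeta, In zeta l -> x <> fst zeta) ->
  is_RInt (fun y => fst (csum l (fun zeta => INR (mu zeta) / ((x, y) - zeta))%C)) (- Y) Y
    (rsum l (vertical_angle mu Y x)).
Proof.
  intros HY; induction l as [|[xi eta] l IH]; intros H.
  - simpl. evar_last; [apply (is_RInt_const (V := R_NormedModule))|].
    unfold scal; simpl; unfold mult; simpl; ring.
  - assert (Hx : x <> xi) by (apply (H (xi, eta)); left; reflexivity).
    apply (is_RInt_plus (V := R_NormedModule)
             (fun y => fst (INR (mu (xi, eta)) / ((x, y) - (xi, eta)))%C)).
    + apply is_RInt_ext with
        (fun y => INR (mu (xi, eta)) * ((x - xi) / ((x - xi) ^ 2 + (y - eta) ^ 2))).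
      { intros y _; rewrite simple_pole_parts; reflexivity. }
      assert (Dn : forall y, (x - xi) ^ 2 + (y - eta) ^ 2 <> 0).
      { intros y; assert (0 < (x - xi) ^ 2) by (apply pow2_gt_0; lra).
        assert (0 <= (y - eta) ^ 2) by apply pow2_ge_0; lra. }
      evar_last.
      * apply (is_RInt_derive (V := R_CompleteNormedModule)
                 (fun y => INR (mu (xi, eta)) * atan ((y - eta) / (x - xi)))).
        -- intros y _; specialize (Dn y). auto_derive; [lra|].
           field; repeat split; try lra; try assumption.
        -- intros y _. apply (continuous_mult (K := R_AbsRing)); [apply continuous_const|].
           apply (ex_derive_continuous (K := R_AbsRing) (V := R_NormedModule)).
           specialize (Dn y); auto_derive; simpl in Dn; assumption.
      * unfold vertical_angle, minus, plus, opp; simpl.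
        replace ((- Y - eta) / (x - xi)) with (- ((Y + eta) / (x - xi))) by (field; lra).
        rewrite atan_opp; ring.
    + apply IH; intros; apply H; right; assumption.
Qed.

Lemma atan_complement (u v : R) : 0 < u -> 0 < v -> atan (u / v) + atan (v / u) = PI / 2.
Proof.
  intros Hu Hv.
  replace (v / u) with (/ (u / v)) by (field; lra).
  rewrite atan_inv; [ring|apply Rdiv_lt_0_compat; assumption].
Qed.

(** For each zero the four arctangents form two pairs with reciprocal positive arguments, each pair
    worth [PI / 2]. *)
Lemma total_angle_right (mu : C -> nat) (Y x : R) (l : list C) :
  (forall zeta, In zeta l -> fst zeta < x /\ - Y < snd zeta < Y) ->
  rsum l (vertical_angle mu Y x) + rsum l (horizontal_angle mu Y x)
  = PI * INR (total_multiplicity mu l).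
Proof.
  induction l as [|[xi eta] l IH]; intros H; unfold total_multiplicity; simpl; [ring|].
  rewrite plus_INR, Rmult_plus_distr_l; fold (total_multiplicity mu l).
  rewrite <- IH by (intros; apply H; right; assumption).
  destruct (H (xi, eta)) as [H1 H2]; [left; reflexivity|]; simpl in H1, H2.
  unfold vertical_angle at 1, horizontal_angle at 1; simpl fst; simpl snd.
  assert (E1 := atan_complement (Y - eta) (x - xi) ltac:(lra) ltac:(lra)).
  assert (E2 := atan_complement (Y + eta) (x - xi) ltac:(lra) ltac:(lra)).
  set (P := PI) in *; replace P with (P / 2 + P / 2) by field.
  rewrite <- E1 at 1; rewrite <- E2; ring.
Qed.

(** To the left of the zeros every argument changes sign. Between the two ends the total therefore
    jumps by [2 PI] per zero with multiplicity, which is the source of [2 PI N]. *)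
Lemma total_angle_left (mu : C -> nat) (Y x : R) (l : list C) :
  (forall zeta, In zeta l -> x < fst zeta /\ - Y < snd zeta < Y) ->
  rsum l (vertical_angle mu Y x) + rsum l (horizontal_angle mu Y x)
  = - PI * INR (total_multiplicity mu l).
Proof.
  induction l as [|[xi eta] l IH]; intros H; unfold total_multiplicity; simpl; [ring|].
  rewrite plus_INR, Rmult_plus_distr_l; fold (total_multiplicity mu l).
  rewrite <- IH by (intros; apply H; right; assumption).
  destruct (H (xi, eta)) as [H1 H2]; [left; reflexivity|]; simpl in H1, H2.
  unfold vertical_angle at 1, horizontal_angle at 1; simpl fst; simpl snd.
  assert (E1 := atan_complement (Y - eta) (xi - x) ltac:(lra) ltac:(lra)).
  assert (E2 := atan_complement (Y + eta) (xi - x) ltac:(lra) ltac:(lra)).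
  replace ((Y - eta) / (x - xi)) with (- ((Y - eta) / (xi - x))) by (field; lra).
  replace ((Y + eta) / (x - xi)) with (- ((Y + eta) / (xi - x))) by (field; lra).
  replace ((x - xi) / (Y - eta)) with (- ((xi - x) / (Y - eta))) by (field; lra).
  replace ((x - xi) / (Y + eta)) with (- ((xi - x) / (Y + eta))) by (field; lra).
  rewrite !atan_opp.
  set (P := PI) in *; replace (- P) with (- (P / 2 + P / 2)) by field.
  rewrite <- E1 at 1; rewrite <- E2; ring.
Qed.

Lemma vertical_integral_uniform (g : C -> C) (a b Y : R) :
  0 < Y -> (forall z : C, a <= fst z <= b -> cont_at g z) ->
  forall eps, 0 < eps -> exists delta, 0 < delta /\ forall x u,
    a <= x <= b -> a <= u <= b -> Rabs (u - x) < delta ->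
    Rabs (RInt (fun y => fst (g (u, y))) (- Y) Y - RInt (fun y => fst (g (x, y))) (- Y) Y) < eps.
Proof.
  intros HY Hg eps He.
  assert (He' : 0 < eps / (4 * Y)) by (apply Rdiv_lt_0_compat; lra).
  destruct (uniform_continuity_2d (fun u v => fst (g (u, v))) a b (- Y) Y) with (eps := mkposreal _ He')
    as [delta Hd].
  { intros x y Hx _; apply (Hg (x, y)); exact Hx. }
  exists delta; split; [apply delta|]; intros x u Hx Hu Hux.
  assert (Ix : ex_RInt (fun y => fst (g (x, y))) (- Y) Y).
  { apply ex_RInt_line; [exact HY|intros y _; apply Hg; exact Hx]. }
  assert (Iu : ex_RInt (fun y => fst (g (u, y))) (- Y) Y).
  { apply ex_RInt_line; [exact HY|intros y _; apply Hg; exact Hu]. }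
  assert (E := RInt_minus _ _ _ _ Iu Ix).
  unfold minus, plus, opp in E; simpl in E; unfold Rminus; rewrite <- E.
  eapply Rle_lt_trans.
  - apply (abs_RInt_le_const _ (- Y) Y (eps / (4 * Y))); [lra| |].
    + apply (ex_RInt_minus _ _ _ _ Iu Ix).
    + intros y Hy; left; apply (Hd x y u y); try assumption.
      rewrite Rminus_diag, Rabs_R0; apply delta.
  - replace ((Y - - Y) * (eps / (4 * Y))) with (eps / 2) by (field; lra); lra.
Qed.

(* The argument principle on [[a, b] x [-Y, Y]] in quantitative form: the vertical
   integral of [Re (f'/f - polar parts)] is continuous in [x] even across zeros, and
   Cauchy-Riemann gives its derivative in terms of the two horizontal sides. *)
Lemma argument_principle_estimate (f f' f'' : C -> C) (l : list C) (mu : C -> nat)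
    (c : C -> C) (a b Y kappa E M : R) :
  a < b -> 0 < Y -> 0 <= E ->
  (forall z, holo_at f f' z /\ holo_at f' f'' z) ->
  (forall z, cont_at f z /\ cont_at f' z /\ cont_at f'' z) ->
  NoDup l ->
  (forall zeta, In zeta l -> f zeta = 0%C /\ a < fst zeta < b /\ - Y < snd zeta < Y /\
     log_derivative_residue f f' zeta (mu zeta) (c zeta)) ->
  (forall z : C, a <= fst z <= b -> f z = 0%C -> In z l) ->
  (forall x, a < x < b ->
     Rabs (snd (f' (x, (- Y)%R) / f (x, (- Y)%R))%C - snd (f' (x, Y) / f (x, Y))%C - kappa) <= E) ->
  (forall y, - Y <= y <= Y -> Rabs (fst (f' (a, y) / f (a, y))%C) <= M /\
                              Rabs (fst (f' (b, y) / f (b, y))%C) <= M) ->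
  Rabs (2 * PI * INR (total_multiplicity mu l) - kappa * (b - a)) <= E * (b - a) + 4 * Y * M.
Proof.
  intros Hab HY HE Hholo Hcont Hl Hz Hall Hhor Hver.
  set (g := regularised f f' l mu c).
  assert (Hg : forall z : C, a <= fst z <= b -> cont_at g z).
  { intros z Hzab; destruct (Hcont z) as (C0 & C1 & _).
    destruct (classic (f z = 0%C)) as [e|n].
    - apply cont_at_regularised_zero; try assumption; [auto|].
      apply (Hz z); auto.
    - apply cont_at_regularised_off; try assumption.
      intros Hi; apply n; apply (Hz z Hi). }
  pose (J := (fun x => RInt (fun y => fst (g (x, y))) (- Y) Y) : R -> R).
  set (A := fun x => rsum l (horizontal_angle mu Y x)).
  set (sing := fun z => csum l (fun zeta => INR (mu zeta) / (z - zeta))%C).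
  assert (HA : forall x : R, is_derive A x (snd (sing (x, (- Y)%R)) - snd (sing (x, Y)))).
  { intros x; apply is_derive_horizontal_angle; intros zeta Hi; apply (Hz zeta Hi). }
  (* On a vertical line without zeros the special values at the poles are invisible, and [g] is the
     ordinary holomorphic difference. *)
  assert (Eg : forall z, ~ In (fst z) (map fst l) -> g z = (f' z / f z - sing z)%C).
  { intros z Hn; unfold g, regularised, sing; f_equal.
    apply csum_ext; intros zeta Hi; apply polar_part_off; intros ->.
    apply Hn; apply in_map; exact Hi. }
  assert (Hend : forall x, a <= x <= b -> (forall zeta, In zeta l -> x <> fst zeta) ->
     J x = RInt (fun y => fst (f' (x, y) / f (x, y))%C) (- Y) Y - rsum l (vertical_angle mu Y x)
     /\ ex_RInt (fun y => fst (f' (x, y) / f (x, y))%C) (- Y) Y).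
  { intros x Hx Hn.
    assert (Hn' : ~ In x (map fst l)).
    { intros Hi; apply in_map_iff in Hi; destruct Hi as (zeta & e & Hi); apply (Hn zeta Hi); auto. }
    assert (I : ex_RInt (fun y => fst (f' (x, y) / f (x, y))%C) (- Y) Y).
    { apply (ex_RInt_line (fun z => f' z / f z)%C); [exact HY|]; intros y _.
      apply cont_at_mult; [apply Hcont|apply cont_at_inv; [apply Hcont|]].
      intros e; apply Hn'; apply (in_map fst l (x, y)); apply Hall; assumption. }
    split; [|exact I].
    unfold J; apply is_RInt_unique.
    eapply is_RInt_ext; [intros y _; rewrite Eg by exact Hn'; reflexivity|].
    apply (is_RInt_minus (V := R_NormedModule) (fun y => fst (f' (x, y) / f (x, y))%C)
             (fun y => fst (sing (x, y)))).
    - apply (RInt_correct (V := R_CompleteNormedModule)); exact I.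
    - apply is_RInt_vertical_angle; assumption. }
  (* Subtracting [A] cancels the contribution of [sing] to the derivative of [J]. What remains is
     [Im (f'/f)] at the top minus at the bottom, within [E] of [- kappa] by hypothesis. *)
  assert (Key : Rabs ((J b - A b) - (J a - A a) - (- kappa) * (b - a)) <= E * (b - a)).
  { apply (mean_value_off_finite (map fst l) (fun x => J x - A x)); [lra|exact HE| |].
    - intros eps He.
      destruct (vertical_integral_uniform g a b Y HY Hg (eps / 2)) as (d1 & Hd1 & H1); [lra|].
      assert (He2 : 0 < eps / 2) by lra.
      destruct (fun H => @Heine_cor2 A a b H (mkposreal _ He2)) as [d2 H2].
      { intros x _; apply derivable_continuous_pt; eexists; apply is_derive_Reals, HA. }
      exists (Rmin d1 d2); split; [apply Rmin_glb_lt; [exact Hd1|apply d2]|].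
      intros x u Hx Hu Hux.
      assert (T1 := Rmin_l d1 d2); assert (T2 := Rmin_r d1 d2).
      specialize (H1 x u Hx Hu ltac:(lra)); specialize (H2 u x Hu Hx ltac:(lra)); simpl in H2.
      fold (J u) (J x) in H1.
      replace (J u - A u - (J x - A x)) with ((J u - J x) + - (A u - A x)) by ring.
      eapply Rle_lt_trans; [apply Rabs_triang|]; rewrite Rabs_Ropp; lra.
    - intros x Hx Hn.
      destruct (away_from_finite _ _ Hn) as (d0 & Hd0 & Haway).
      set (d := Rmin d0 (Rmin (x - a) (b - x))).
      assert (Hd : 0 < d) by (repeat apply Rmin_glb_lt; lra).
      assert (T1 := Rmin_l d0 (Rmin (x - a) (b - x))); assert (T2 := Rmin_r d0 (Rmin (x - a) (b - x))).
      assert (T3 := Rmin_l (x - a) (b - x)); assert (T4 := Rmin_r (x - a) (b - x)); fold d in T1, T2.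
      assert (Hstrip : forall z : C, Rabs (fst z - x) < d -> f z <> 0%C /\ ~ In (fst z) (map fst l)).
      { intros z Hzd; assert (N : ~ In (fst z) (map fst l)) by (apply Haway; lra).
        split; [|exact N]; intros e; apply N; apply in_map; apply Hall; [|exact e].
        apply Rabs_def2 in Hzd; lra. }
      assert (Hh : holo_on (fun z => Rabs (fst z - x) < d) (fun z => f' z / f z - sing z)%C).
      { apply holo_on_minus.
        - apply holo_on_div.
          + exists f''; intros z _; split; [apply Hholo|split; apply Hcont].
          + exists f'; intros z _; split; [apply Hholo|split; apply Hcont].
          + intros z Hzd; apply Hstrip; exact Hzd.
        - apply (holo_on_csum _ l (fun zeta z => INR (mu zeta) / (z - zeta))%C).
          intros zeta Hi; apply holo_on_div; [apply holo_on_const| |].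
          + apply holo_on_minus; [|apply holo_on_const].
            exists (fun _ => 1%C); intros z _; split; [apply holo_at_id|split; [apply cont_at_id|apply cont_at_const]].
          + intros z Hzd e; apply (proj2 (Hstrip z Hzd)).
            replace z with ((z - zeta) + zeta)%C by ring; rewrite e.
            replace (0 + zeta)%C with zeta by ring; apply in_map; exact Hi. }
      assert (DJ := vertical_integral_derive _ x d Y Hd HY Hh).
      assert (DJ' : is_derive J x
        (snd (f' (x, Y) / f (x, Y) - sing (x, Y))%C - snd (f' (x, (- Y)%R) / f (x, (- Y)%R) - sing (x, (- Y)%R))%C)).
      { eapply is_derive_ext_loc; [|exact DJ].
        exists (mkposreal _ Hd); intros t Ht; unfold J.
        apply RInt_ext; intros y _; rewrite Eg; [reflexivity|].
        apply (Hstrip (t, y)); exact Ht. }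
      eexists; split.
      + apply (is_derive_minus (V := R_NormedModule)); [exact DJ'|apply HA].
      + replace (minus _ _ - - kappa) with
          (- (snd (f' (x, (- Y)%R) / f (x, (- Y)%R))%C - snd (f' (x, Y) / f (x, Y))%C - kappa)).
        * rewrite Rabs_Ropp; apply Hhor; exact Hx.
        * generalize (sing (x, Y)) (sing (x, (- Y)%R)) (f' (x, Y) / f (x, Y))%C
            (f' (x, (- Y)%R) / f (x, (- Y)%R))%C; intros u1 u2 u3 u4.
          unfold minus, plus, opp; simpl; ring. }
  destruct (Hend a) as [Ea Ia]; [lra|intros zeta Hi; destruct (Hz zeta Hi) as (_ & H & _); lra|].
  destruct (Hend b) as [Eb Ib]; [lra|intros zeta Hi; destruct (Hz zeta Hi) as (_ & H & _); lra|].
  assert (Ra := total_angle_left mu Y a l).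
  assert (Rb := total_angle_right mu Y b l).
  fold (A a) in Ra; fold (A b) in Rb.
  rewrite Ea, Eb in Key.
  assert (Ba : Rabs (RInt (fun y => fst (f' (a, y) / f (a, y))%C) (- Y) Y) <= (Y - - Y) * M).
  { apply abs_RInt_le_const; [lra|exact Ia|intros; apply Hver; assumption]. }
  assert (Bb : Rabs (RInt (fun y => fst (f' (b, y) / f (b, y))%C) (- Y) Y) <= (Y - - Y) * M).
  { apply abs_RInt_le_const; [lra|exact Ib|intros; apply Hver; assumption]. }
  specialize (Ra ltac:(intros zeta Hi; destruct (Hz zeta Hi) as (_ & ? & ? & _); lra)).
  specialize (Rb ltac:(intros zeta Hi; destruct (Hz zeta Hi) as (_ & ? & ? & _); lra)).
  set (N := INR (total_multiplicity mu l)) in *.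
  set (Pa := RInt (fun y => fst (f' (a, y) / f (a, y))%C) (- Y) Y) in *.
  set (Pb := RInt (fun y => fst (f' (b, y) / f (b, y))%C) (- Y) Y) in *.
  (* By the angle totals, [J b - A b] is [Pb - PI * N] and [J a - A a] is [Pa + PI * N]. *)
  replace (2 * PI * N - kappa * (b - a)) with
    (- (Pb - rsum l (vertical_angle mu Y b) - A b - (Pa - rsum l (vertical_angle mu Y a) - A a)
        - - kappa * (b - a)) + (Pb - Pa)).
  2:{ replace (Pb - rsum l (vertical_angle mu Y b) - A b) with
        (Pb - (rsum l (vertical_angle mu Y b) + A b)) by ring.
      replace (Pa - rsum l (vertical_angle mu Y a) - A a) with
        (Pa - (rsum l (vertical_angle mu Y a) + A a)) by ring.
      rewrite Ra, Rb; ring. }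
  eapply Rle_trans; [apply Rabs_triang|]; rewrite Rabs_Ropp.
  assert (T := Rabs_triang Pb (- Pa)); rewrite Rabs_Ropp in T; unfold Rminus in *; lra.
Qed.

(** * The characteristic function *)

Lemma cont_at_real_scaling (a : R) (f : C -> C) (z : C) :
  cont_at f (a * z)%C -> cont_at (fun w => f (a * w)%C) z.
Proof.
  destruct z as [x y].
  assert (E : forall u v : R, (a * (u, v))%C = ((a * u)%R, (a * v)%R)).
  { intros; unfold Cmult, Complex.RtoC; simpl; f_equal; ring. }
  assert (H : forall h : R -> R -> R, continuity_2d_pt h (a * x) (a * y) ->
     continuity_2d_pt (fun u v => h (a * u) (a * v)) x y).
  { intros h Hh eps; destruct (Hh eps) as [d Hd].
    assert (Ha := Rabs_pos a); assert (d0 := cond_pos d).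
    assert (Hp : 0 < d / (Rabs a + 1)) by (apply Rdiv_lt_0_compat; lra).
    assert (K : forall s t, Rabs (s - t) < d / (Rabs a + 1) -> Rabs (a * s - a * t) < d).
    { intros s t Hst; rewrite <- Rmult_minus_distr_l, Rabs_mult.
      apply Rlt_div_r in Hst; [|lra]. assert (T := Rabs_pos (s - t)); nra. }
    exists (mkposreal _ Hp); simpl; intros u v Hu Hv; apply Hd; apply K; assumption. }
  rewrite E; intros [A1 A2]; split; simpl fst in *; simpl snd in *.
  - apply continuity_2d_pt_ext with (2 := H _ A1); intros u v; rewrite E; reflexivity.
  - apply continuity_2d_pt_ext with (2 := H _ A2); intros u v; rewrite E; reflexivity.
Qed.

Fixpoint sin_deriv (k : nat) (z : C) : C :=
  match k with
  | O => Csin z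
  | S O => Ccos z
  | S (S k') => (- sin_deriv k' z)%C
  end.

Lemma is_derive_cosh (x : R) : is_derive cosh x (sinh x).
Proof. apply is_derive_Reals, derivable_pt_lim_cosh. Qed.

Lemma is_derive_sinh (x : R) : is_derive sinh x (cosh x).
Proof. apply is_derive_Reals, derivable_pt_lim_sinh. Qed.

Lemma is_derive_scal_l (f : R -> R) (x l k : R) :
  is_derive f x l -> is_derive (fun t => k * f t) x (k * l).
Proof. intros H; apply (is_derive_scal f x k l H). Qed.

Lemma is_derive_scal_r (f : R -> R) (x l k : R) :
  is_derive f x l -> is_derive (fun t => f t * k) x (l * k).
Proof.
  intros H; apply is_derive_ext with (fun t => k * f t); [intros t; apply Rmult_comm|].
  rewrite Rmult_comm; apply is_derive_scal_l; exact H.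
Qed.

Lemma holo_at_Csin (z : C) : holo_at Csin Ccos z.
Proof.
  destruct z as [x y]; unfold holo_at, Csin, Ccos, Re, Im; simpl fst; simpl snd.
  rewrite Ropp_involutive; split4.
  - apply is_derive_scal_r, is_derive_sin.
  - rewrite Ropp_mult_distr_l; apply is_derive_scal_r, is_derive_cos.
  - apply is_derive_scal_l, is_derive_cosh.
  - apply is_derive_scal_l, is_derive_sinh.
Qed.

Lemma holo_at_Ccos (z : C) : holo_at Ccos (fun w => - Csin w)%C z.
Proof.
  destruct z as [x y]; unfold holo_at, Csin, Ccos, Re, Im, Copp; simpl fst; simpl snd.
  rewrite Ropp_involutive; split4.
  - rewrite Ropp_mult_distr_l; apply is_derive_scal_r, is_derive_cos.
  - apply (is_derive_opp (V := R_NormedModule)), is_derive_scal_r, is_derive_sin.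
  - apply is_derive_scal_l, is_derive_cosh.
  - apply (is_derive_opp (V := R_NormedModule)), is_derive_scal_l, is_derive_sinh.
Qed.

Lemma holo_at_opp (f f' : C -> C) (z : C) :
  holo_at f f' z -> holo_at (fun w => - f w)%C (fun w => - f' w)%C z.
Proof.
  intros H; eapply holo_at_ext; [| |apply (holo_at_minus _ _ _ _ z (holo_at_const 0%C z) H)].
  - intros w; cbv beta; ring.
  - cbv beta; ring.
Qed.

Lemma cont_at_opp (f : C -> C) (z : C) : cont_at f z -> cont_at (fun w => - f w)%C z.
Proof.
  intros H; apply cont_at_ext with (fun w => 0 - f w)%C; [intros w; ring|].
  apply cont_at_minus; [apply cont_at_const|exact H].
Qed.

Lemma derivative_chain_sin : derivative_chain sin_deriv.
Proof.
  assert (S2 : forall g h : R -> R, (forall t, continuity_pt g t) -> (forall t, continuity_pt h t) ->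
    forall x y, continuity_2d_pt (fun u v => g u * h v) x y).
  { intros g h Hg Hh x y; apply continuity_2d_pt_mult.
    - apply (continuity_1d_2d_pt_comp g (fun u _ => u)); [apply Hg|apply continuity_2d_pt_id1].
    - apply (continuity_1d_2d_pt_comp h (fun _ v => v)); [apply Hh|apply continuity_2d_pt_id2]. }
  assert (Hch : forall t, continuity_pt cosh t).
  { intros t; apply derivable_continuous_pt; eexists; apply derivable_pt_lim_cosh. }
  assert (Hsh : forall t, continuity_pt sinh t).
  { intros t; apply derivable_continuous_pt; eexists; apply derivable_pt_lim_sinh. }
  (* Two consecutive indices are carried together because [sin_deriv] recurs by steps of two. *)
  assert (H : forall k z, (holo_at (sin_deriv k) (sin_deriv (S k)) z /\ cont_at (sin_deriv k) z) /\
                     (holo_at (sin_deriv (S k)) (sin_deriv (S (S k))) z /\ cont_at (sin_deriv (S k)) z)).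
  { induction k as [|k IH]; intros z.
    - split; split.
      + apply holo_at_Csin.
      + split; [apply (S2 sin cosh)|apply (S2 cos sinh)]; auto; intros t;
          first [apply continuity_sin|apply continuity_cos].
      + apply holo_at_Ccos.
      + split; [apply (S2 cos cosh)|apply continuity_2d_pt_opp, (S2 sin sinh)]; auto; intros t;
          first [apply continuity_sin|apply continuity_cos].
    - split; [apply IH|split].
      + apply (holo_at_opp (sin_deriv k) (sin_deriv (S k))), IH.
      + apply (cont_at_opp (sin_deriv k)), IH. }
  intros k z; apply H.
Qed.

(* The [k]-th derivative of [F], whose two terms come from the product-to-sum formulas. *)
Definition char_chain (gamma : R) (k : nat) (z : C) : C :=
  (((gamma - 1) / 2 * (1 + gamma) ^ k)%R * sin_deriv k ((1 + gamma)%R * z)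
   - ((1 + gamma) / 2 * (gamma - 1) ^ k)%R * sin_deriv k ((gamma - 1)%R * z))%C.

Lemma derivative_chain_char (gamma : R) : derivative_chain (char_chain gamma).
Proof.
  assert (T : forall (a q : R) k z,
    holo_at (fun w => (a * q ^ k)%R * sin_deriv k (q * w))%C
            (fun w => (a * q ^ S k)%R * sin_deriv (S k) (q * w))%C z /\
    cont_at (fun w => (a * q ^ k)%R * sin_deriv k (q * w))%C z).
  { intros a q k z; destruct (derivative_chain_sin k (q * z)%C) as [H1 H2]; split.
    - eapply holo_at_ext; [| |apply holo_at_scal, holo_at_real_scaling, H1].
      + intros w; reflexivity.
      + cbv beta. rewrite Cmult_assoc, <- RtoC_mult. f_equal; f_equal; simpl; ring.
    - apply cont_at_mult; [apply cont_at_const|].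
      apply cont_at_real_scaling, H2. }
  intros k z; split.
  - apply holo_at_minus; apply T.
  - apply cont_at_minus; apply T.
Qed.

Lemma cosh_sum (a b : R) : cosh (a + b) = cosh a * cosh b + sinh a * sinh b.
Proof. unfold cosh, sinh; rewrite Ropp_plus_distr, !exp_plus; field. Qed.

Lemma sinh_sum (a b : R) : sinh (a + b) = sinh a * cosh b + cosh a * sinh b.
Proof. unfold cosh, sinh; rewrite Ropp_plus_distr, !exp_plus; field. Qed.

Lemma cosh_opp (a : R) : cosh (- a) = cosh a.
Proof. unfold cosh; rewrite Ropp_involutive; field. Qed.

Lemma sinh_opp (a : R) : sinh (- a) = - sinh a.
Proof. unfold sinh; rewrite Ropp_involutive; field. Qed.

Lemma exp_mult_opp (y : R) : exp y * exp (- y) = 1.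
Proof. rewrite <- exp_plus, Rplus_opp_r; apply exp_0. Qed.

Lemma le_of_pow2_le (a b : R) : a ^ 2 <= b ^ 2 -> 0 <= b -> a <= b.
Proof. intros H Hb; apply Rsqr_incr_0_var; [unfold Rsqr; lra|exact Hb]. Qed.

Lemma cosh_ge_1 (y : R) : 1 <= cosh y.
Proof.
  unfold cosh; assert (H1 := exp_pos y); assert (H2 := exp_pos (- y)).
  apply le_of_pow2_le; [|lra].
  rewrite <- (exp_mult_opp y) at 1.
  assert (H := exp_mult_opp y); assert (T := pow2_ge_0 (exp y - exp (- y))); nra.
Qed.

Lemma Csin_plus (z w : C) : Csin (z + w)%C = (Csin z * Ccos w + Ccos z * Csin w)%C.
Proof.
  destruct z as [x y], w as [u v]; unfold Csin, Ccos, Re, Im, Cmult, Cplus; simpl.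
  rewrite sin_plus, cos_plus, cosh_sum, sinh_sum; f_equal; ring.
Qed.

Lemma Csin_opp (z : C) : Csin (- z)%C = (- Csin z)%C.
Proof.
  destruct z as [x y]; unfold Csin, Re, Im, Copp; simpl.
  rewrite sin_neg, cos_neg, cosh_opp, sinh_opp; f_equal; ring.
Qed.

Lemma Ccos_opp (z : C) : Ccos (- z)%C = Ccos z.
Proof.
  destruct z as [x y]; unfold Ccos, Re, Im, Copp; simpl.
  rewrite sin_neg, cos_neg, cosh_opp, sinh_opp; f_equal; ring.
Qed.

Lemma Fchar_char_chain (gamma : R) (z : C) : Fchar gamma z = char_chain gamma 0 z.
Proof.
  unfold char_chain; simpl sin_deriv; simpl pow.
  replace ((1 + gamma)%R * z)%C with (z + gamma * z)%C by (rewrite RtoC_plus; ring).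
  replace ((gamma - 1)%R * z)%C with (gamma * z + - z)%C by (rewrite RtoC_minus; ring).
  rewrite !Csin_plus, Csin_opp, Ccos_opp.
  change (Fchar gamma z) with
    (gamma * (Csin z * Ccos (gamma * z)) - Csin (gamma * z) * Ccos z)%C.
  generalize (Csin z : C) (Ccos z : C) (Csin (gamma * z)%C : C) (Ccos (gamma * z)%C : C).
  intros [a1 a2] [b1 b2] [c1 c2] [d1 d2].
  unfold Cminus, Cmult, Cplus, Copp, Complex.RtoC; simpl; f_equal; field.
Qed.

(** Orders 0 and 2 involve only sines, orders 1 and 3 only cosines. Each pair is a linear system
    that is invertible since [s^2 - d^2 = 4 gamma] is nonzero. With [d z = x + i y], its real parts
    force [sin x * cosh y] and [cos x * cosh y] to vanish together, which is impossible. *)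
Lemma char_chain_nonvanishing (gamma : R) (z : C) :
  gamma > 0 -> gamma <> 1 -> exists k, char_chain gamma k z <> 0%C.
Proof.
  intros Hg Hg1; apply NNPP; intros N.
  assert (H : forall k, char_chain gamma k z = 0%C).
  { intros k; apply NNPP; intros n; apply N; exists k; exact n. }
  clear N.
  set (s := 1 + gamma); set (d := gamma - 1).
  assert (Hs : s <> 0) by (unfold s; lra).
  assert (Hd : d <> 0) by (unfold d; lra).
  assert (Hsd : s * s - d * d <> 0).
  { replace (s * s - d * d) with (4 * gamma) by (unfold s, d; ring); lra. }
  assert (Lin : forall p p' q q', d / 2 * p - s / 2 * p' = 0 ->
     d * s / 2 * q - s * d / 2 * q' = 0 -> d * (s * s) / 2 * p - s * (d * d) / 2 * p' = 0 ->
     d * (s * s * s) / 2 * q - s * (d * d * d) / 2 * q' = 0 -> p' = 0 /\ q' = 0).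
  { intros p p' q q' E0 E1 E2 E3.
    assert (F1 : q = q').
    { apply Rmult_eq_reg_l with (d * s / 2); [lra|].
      intros e; assert (e' : d * s = 0) by lra; apply Rmult_integral in e'; tauto. }
    subst q'; split.
    - assert (F : s * ((s * s - d * d) * p') = 0).
      { replace (s * ((s * s - d * d) * p')) with
          (2 * (d * (s * s) / 2 * p - s * (d * d) / 2 * p') - 2 * s * s * (d / 2 * p - s / 2 * p')) by field.
        rewrite E0, E2; ring. }
      apply Rmult_integral in F; destruct F as [F|F]; [contradiction|].
      apply Rmult_integral in F; tauto.
    - assert (F : d * (s * ((s * s - d * d) * q)) = 0) by lra.
      apply Rmult_integral in F; destruct F as [F|F]; [contradiction|].
      apply Rmult_integral in F; destruct F as [F|F]; [contradiction|].
      apply Rmult_integral in F; tauto. }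
  assert (H0 := H 0%nat); assert (H1 := H 1%nat); assert (H2 := H 2%nat); assert (H3 := H 3%nat).
  unfold char_chain in H0, H1, H2, H3; fold s d in H0, H1, H2, H3; simpl sin_deriv in *.
  revert H0 H1 H2 H3.
  destruct (d * z)%C as [x y] eqn:Ez.
  generalize (Csin (s * z)%C : C) (Ccos (s * z)%C : C); intros [a1 a2] [b1 b2].
  unfold Cminus, Cmult, Cplus, Copp, Complex.RtoC; simpl.
  intros H0 H1 H2 H3; injection H0; injection H1; injection H2; injection H3.
  unfold Csin, Ccos, Re, Im; simpl; intros.
  destruct (Lin a1 (sin x * cosh y) b1 (cos x * cosh y)); [lra..|].
  assert (ch : 0 < cosh y) by (assert (T := cosh_ge_1 y); lra).
  assert (sin x = 0) by (apply Rmult_eq_reg_r with (cosh y); lra).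
  assert (cos x = 0) by (apply Rmult_eq_reg_r with (cosh y); lra).
  assert (T := sin2_cos2 x); unfold Rsqr in T; nra.
Qed.

Lemma sin_deriv_conj (k : nat) (z : C) :
  sin_deriv k (Complex.Cconj z) = Complex.Cconj (sin_deriv k z).
Proof.
  assert (H : sin_deriv k (Complex.Cconj z) = Complex.Cconj (sin_deriv k z) /\
    sin_deriv (S k) (Complex.Cconj z) = Complex.Cconj (sin_deriv (S k) z)).
  { induction k as [|k [IH1 IH2]].
    - destruct z as [x y]; split; simpl; unfold Csin, Ccos, Complex.Cconj, Re, Im; simpl;
        rewrite cosh_opp, sinh_opp; f_equal; ring.
    - split; [exact IH2|].
      simpl; rewrite IH1; unfold Complex.Cconj, Copp; simpl; reflexivity. }
  apply H.
Qed.

Lemma char_chain_conj (gamma : R) (k : nat) (z : C) :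
  char_chain gamma k (Complex.Cconj z) = Complex.Cconj (char_chain gamma k z).
Proof.
  assert (E : forall a : R, (a * Complex.Cconj z)%C = Complex.Cconj (a * z)%C).
  { intros a; destruct z as [x y]; unfold Cmult, Complex.Cconj, Complex.RtoC; simpl; f_equal; ring. }
  unfold char_chain; rewrite !E, !sin_deriv_conj.
  generalize (sin_deriv k ((1 + gamma)%R * z)%C) (sin_deriv k ((gamma - 1)%R * z)%C).
  intros [a1 a2] [b1 b2]; unfold Cminus, Cmult, Cplus, Copp, Complex.Cconj, Complex.RtoC; simpl.
  f_equal; ring.
Qed.

Lemma snd_div_conj (a b : C) :
  snd (Complex.Cconj a / Complex.Cconj b)%C = - snd (a / b)%C.
Proof.
  destruct a as [a1 a2], b as [b1 b2].
  unfold Cdiv, Cmult, Cinv, Complex.Cconj; simpl.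
  replace (- b2 * (- b2 * 1)) with (b2 * (b2 * 1)) by ring.
  unfold Rdiv; ring.
Qed.

Lemma cosh_sqr_minus_sinh_sqr (y : R) : cosh y ^ 2 - sinh y ^ 2 = 1.
Proof.
  unfold cosh, sinh; rewrite <- (exp_mult_opp y); field.
Qed.

Lemma Cmod_sqr (z : C) : Cmod z ^ 2 = fst z ^ 2 + snd z ^ 2.
Proof.
  unfold Cmod; rewrite pow2_sqrt; [reflexivity|].
  assert (A := pow2_ge_0 (fst z)); assert (B := pow2_ge_0 (snd z)); lra.
Qed.

(** All three bounds come from [|sin z|^2 = sinh^2 y + sin^2 x] and
    [|cos z|^2 = sinh^2 y + cos^2 x]. *)
Lemma Csin_Ccos_bounds (z : C) :
  Cmod (Csin z) <= cosh (snd z) /\ Cmod (Ccos z) <= cosh (snd z) /\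
  Rabs (sinh (snd z)) <= Cmod (Csin z).
Proof.
  destruct z as [x y]; simpl snd; assert (H := cosh_ge_1 y).
  assert (E := cosh_sqr_minus_sinh_sqr y); assert (T := sin2_cos2 x); unfold Rsqr in T.
  assert (Hc : 0 <= cos x ^ 2) by apply pow2_ge_0; assert (Hs : 0 <= sin x ^ 2) by apply pow2_ge_0.
  assert (E1 : Cmod (Csin (x, y)) ^ 2 = sinh y ^ 2 + sin x ^ 2).
  { rewrite Cmod_sqr; unfold Csin, Re, Im; simpl fst; simpl snd.
    replace ((sin x * cosh y) ^ 2 + (cos x * sinh y) ^ 2)
      with ((sin x * sin x + cos x * cos x) * sinh y ^ 2 + sin x ^ 2 * (cosh y ^ 2 - sinh y ^ 2)) by ring.
    rewrite T, E; ring. }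
  assert (E2 : Cmod (Ccos (x, y)) ^ 2 = sinh y ^ 2 + cos x ^ 2).
  { rewrite Cmod_sqr; unfold Ccos, Re, Im; simpl fst; simpl snd.
    replace ((cos x * cosh y) ^ 2 + (- (sin x * sinh y)) ^ 2)
      with ((sin x * sin x + cos x * cos x) * sinh y ^ 2 + cos x ^ 2 * (cosh y ^ 2 - sinh y ^ 2)) by ring.
    rewrite T, E; ring. }
  split; [|split]; apply le_of_pow2_le; try lra.
  - rewrite RPow_abs, Rabs_pos_eq by apply pow2_ge_0; lra.
  - apply Cmod_ge_0.
Qed.

Lemma exp_nondecreasing (x y : R) : x <= y -> exp x <= exp y.
Proof. intros [H|H]; [left; apply exp_increasing; exact H|right; rewrite H; reflexivity]. Qed.

(** Factoring out [exp (|d| y)], the inequality [exp t >= 1 + t] already gives linear growth of the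
    remaining factor, which beats any constant [M]. *)
Lemma sinh_dominates_cosh (s d M : R) :
  Rabs d < s -> exists Y0, 0 < Y0 /\ forall y, Y0 <= y -> M * cosh (d * y) <= sinh (s * y).
Proof.
  intros Hsd.
  assert (Hk : 0 < s - Rabs d) by lra.
  assert (HM := Rabs_pos M); assert (Hd0 := Rabs_pos d).
  exists (2 * Rabs M / (s - Rabs d) + 1).
  assert (0 <= 2 * Rabs M / (s - Rabs d)) by (apply Rdiv_le_0_compat; lra).
  split; [lra|]; intros y Hy.
  assert (Hky : 2 * Rabs M <= (s - Rabs d) * y).
  { replace (2 * Rabs M) with ((s - Rabs d) * (2 * Rabs M / (s - Rabs d))) by (field; lra).
    apply Rmult_le_compat_l; lra. }
  set (e := exp (Rabs d * y)).
  assert (He : 1 <= e).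
  { unfold e; rewrite <- exp_0; apply exp_nondecreasing.
    apply Rmult_le_pos; [apply Rabs_pos|lra]. }
  assert (Hc : cosh (d * y) <= e).
  { assert (L1 : exp (d * y) <= e).
    { apply exp_nondecreasing, Rmult_le_compat_r; [lra|apply Rle_abs]. }
    assert (L2 : exp (- (d * y)) <= e).
    { rewrite Ropp_mult_distr_l; apply exp_nondecreasing, Rmult_le_compat_r; [lra|].
      rewrite <- Rabs_Ropp; apply Rle_abs. }
    unfold cosh; lra. }
  assert (Hexp : e * (1 + (s - Rabs d) * y) <= exp (s * y)).
  { replace (s * y) with (Rabs d * y + (s - Rabs d) * y) by ring.
    rewrite exp_plus; apply Rmult_le_compat_l; [left; apply exp_pos|apply exp_ineq1_le]. }
  assert (Hneg : exp (- (s * y)) <= 1).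
  { rewrite <- exp_0; apply exp_nondecreasing.
    assert (0 <= s * y) by (apply Rmult_le_pos; lra); lra. }
  assert (M * cosh (d * y) <= Rabs M * e).
  { assert (T := cosh_ge_1 (d * y)).
    apply Rle_trans with (Rabs M * cosh (d * y)).
    - apply Rmult_le_compat_r; [lra|apply Rle_abs].
    - apply Rmult_le_compat_l; lra. }
  assert (e * (2 * Rabs M) <= e * ((s - Rabs d) * y)) by (apply Rmult_le_compat_l; lra).
  unfold sinh; lra.
Qed.

Lemma cosh_le_abs (u v : R) : Rabs u <= Rabs v -> cosh u <= cosh v.
Proof.
  assert (A : forall t, cosh (Rabs t) = cosh t).
  { intros t; destruct (Rcase_abs t) as [h|h].
    - rewrite Rabs_left by exact h; apply cosh_opp.
    - rewrite Rabs_pos_eq by lra; reflexivity. }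
  rewrite <- (A u), <- (A v); assert (Hu := Rabs_pos u); intros H.
  destruct (MVT_gen cosh (Rabs u) (Rabs v) sinh) as (xi & Hxi & E).
  { intros t _; apply is_derive_cosh. }
  { intros t _; apply derivable_continuous_pt; eexists; apply derivable_pt_lim_cosh. }
  rewrite Rmin_left, Rmax_right in Hxi by lra.
  assert (0 <= sinh xi).
  { unfold sinh; assert (exp (- xi) <= exp xi) by (apply exp_nondecreasing; lra); lra. }
  assert (0 <= sinh xi * (Rabs v - Rabs u)) by (apply Rmult_le_pos; lra).
  lra.
Qed.

Lemma snd_real_mult (a : R) (z : C) : snd (a * z)%C = a * snd z.
Proof. unfold Cmult, Complex.RtoC; simpl; ring. Qed.

Lemma char_chain_lower (gamma : R) (z : C) :
  gamma > 0 ->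
  Rabs (gamma - 1) / 2 * Rabs (sinh ((1 + gamma) * snd z))
    - (1 + gamma) / 2 * cosh ((gamma - 1) * snd z) <= Cmod (char_chain gamma 0 z).
Proof.
  intros Hg; unfold char_chain; simpl sin_deriv; simpl pow.
  eapply Rle_trans; [|apply Cmod_minus_ge].
  rewrite !Cmod_mult, !Cmod_R, !Rmult_1_r.
  destruct (Csin_Ccos_bounds ((1 + gamma)%R * z)%C) as (_ & _ & B1).
  destruct (Csin_Ccos_bounds ((gamma - 1)%R * z)%C) as (B2 & _ & _).
  rewrite snd_real_mult in B1, B2.
  assert (Ed : Rabs ((gamma - 1) / 2) = Rabs (gamma - 1) / 2).
  { unfold Rdiv; rewrite Rabs_mult, (Rabs_pos_eq (/ 2)) by lra; reflexivity. }
  rewrite Ed, (Rabs_pos_eq ((1 + gamma) / 2)) by lra.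
  assert (T := Rabs_pos (gamma - 1)).
  assert (Rabs (gamma - 1) / 2 * Rabs (sinh ((1 + gamma) * snd z)) <=
          Rabs (gamma - 1) / 2 * Cmod (Csin ((1 + gamma)%R * z)%C)) by (apply Rmult_le_compat_l; lra).
  assert ((1 + gamma) / 2 * Cmod (Csin ((gamma - 1)%R * z)%C) <=
          (1 + gamma) / 2 * cosh ((gamma - 1) * snd z)) by (apply Rmult_le_compat_l; lra).
  lra.
Qed.

Lemma char_chain_zeros_in_strip (gamma : R) :
  gamma > 0 -> gamma <> 1 ->
  exists Cg, Cg > 0 /\ forall z, char_chain gamma 0 z = 0%C -> Rabs (snd z) <= Cg.
Proof.
  intros Hg Hg1.
  set (D := Rabs (gamma - 1)).
  assert (HD : 0 < D) by (apply Rabs_pos_lt; lra).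
  assert (HDs : D < 1 + gamma) by (unfold D; apply Rabs_def1; lra).
  (* After multiplication by [D / 2] this factor exceeds [(1 + gamma) / 2] by [D / 2], so the lower
     bound for [|F|] is strictly positive above [Y0]. *)
  destruct (sinh_dominates_cosh (1 + gamma) (gamma - 1) ((1 + gamma) / D + 1) HDs) as (Y0 & HY0 & H).
  exists Y0; split; [exact HY0|]; intros z Hz.
  destruct (Rle_dec (Rabs (snd z)) Y0) as [h|h]; [exact h|exfalso].
  assert (L := char_chain_lower gamma z Hg); rewrite Hz, Cmod_0 in L; fold D in L.
  specialize (H (Rabs (snd z)) ltac:(lra)).
  assert (E1 : sinh ((1 + gamma) * Rabs (snd z)) <= Rabs (sinh ((1 + gamma) * snd z))).
  { destruct (Rcase_abs (snd z)) as [n|n].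
    - rewrite (Rabs_left (snd z)) by lra.
      replace ((1 + gamma) * - snd z) with (- ((1 + gamma) * snd z)) by ring.
      rewrite sinh_opp, <- Rabs_Ropp; apply Rle_abs.
    - rewrite (Rabs_pos_eq (snd z)) by lra; apply Rle_abs. }
  assert (E2 : cosh ((gamma - 1) * Rabs (snd z)) = cosh ((gamma - 1) * snd z)).
  { destruct (Rcase_abs (snd z)) as [n|n].
    - rewrite (Rabs_left (snd z)) by lra.
      replace ((gamma - 1) * - snd z) with (- ((gamma - 1) * snd z)) by ring.
      apply cosh_opp.
    - rewrite (Rabs_pos_eq (snd z)) by lra; reflexivity. }
  rewrite E2 in H.
  set (ch := cosh ((gamma - 1) * snd z)) in *.
  assert (1 <= ch) by apply cosh_ge_1.
  assert (D / 2 * (((1 + gamma) / D + 1) * ch) <= D / 2 * Rabs (sinh ((1 + gamma) * snd z))).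
  { apply Rmult_le_compat_l; lra. }
  replace (D / 2 * (((1 + gamma) / D + 1) * ch)) with ((1 + gamma) / 2 * ch + D / 2 * ch) in * by (field; lra).
  assert (0 < D / 2 * ch) by (apply Rmult_lt_0_compat; lra).
  lra.
Qed.

(** In [F' + i s F] the fast terms combine into a multiple of [exp (i s z)], which is bounded in the
    upper half-plane. What is left has size [cosh (d Y)], negligible against [F]. *)
Lemma char_log_derivative_top (gamma E : R) :
  gamma > 0 -> gamma <> 1 -> 0 < E ->
  exists Y0, 0 < Y0 /\ forall x Y, Y0 <= Y ->
    Rabs (snd (char_chain gamma 1 (x, Y) / char_chain gamma 0 (x, Y))%C + (1 + gamma)) <= E.
Proof.
  intros Hg Hg1 HE.
  set (s := 1 + gamma); set (d := gamma - 1); set (D := Rabs d).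
  assert (HD : 0 < D) by (apply Rabs_pos_lt; unfold d; lra).
  assert (HDs : D < s) by (unfold D, d, s; apply Rabs_def1; lra).
  set (K := 2 * s * D + s * s).
  assert (HK : 0 < K) by (unfold K; nra).
  (* [K * ch] will bound [F' + i s F]; this multiplier makes [|F|] at least [K / E * ch], so that
     the quotient is at most [E]. *)
  destruct (sinh_dominates_cosh s d ((s + 2 * K / E) / D) HDs) as (Y0 & HY0 & H).
  exists Y0; split; [exact HY0|]; intros x Y HY.
  specialize (H Y HY).
  set (z := (x, Y) : C).
  set (f := char_chain gamma 0 z); set (f1 := char_chain gamma 1 z).
  assert (L := char_chain_lower gamma z Hg); fold f s d D in L; simpl snd in L.
  set (ch := cosh (d * Y)) in *.
  assert (Hch : 1 <= ch) by apply cosh_ge_1.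
  assert (Lf : K / E * ch <= Cmod f).
  { assert (D / 2 * ((s + 2 * K / E) / D * ch) <= D / 2 * Rabs (sinh (s * Y))).
    { apply Rmult_le_compat_l; [lra|]. eapply Rle_trans; [exact H|apply Rle_abs]. }
    replace (D / 2 * ((s + 2 * K / E) / D * ch)) with (s / 2 * ch + K / E * ch) in * by (field; lra).
    lra. }
  assert (HKE : 0 < K / E) by (apply Rdiv_lt_0_compat; lra).
  assert (Lf0 : 0 < Cmod f) by nra.
  assert (Hf : f <> 0%C) by (apply Cmod_pos_neq; exact Lf0).
  assert (G : (f1 / f + (0, s) = (f1 + (0, s) * f) / f)%C) by (field; exact Hf).
  replace (snd (f1 / f)%C + s) with (snd (f1 / f + (0, s))%C) by reflexivity.
  rewrite G; eapply Rle_trans; [apply abs_snd_le_Cmod|].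
  rewrite Cmod_div by exact Hf.
  apply Rle_div_l; [exact Lf0|].
  apply Rle_trans with (K * ch).
  2:{ replace (K * ch) with (E * (K / E * ch)) by (field; lra). apply Rmult_le_compat_l; lra. }
  destruct (Csin_Ccos_bounds (d * z)%C) as (B1 & B2 & _).
  rewrite snd_real_mult in B1, B2; simpl snd in B1, B2; fold ch in B1, B2.
  set (T := (Ccos (s * z) + (0, 1) * Csin (s * z))%C).
  assert (HT : Cmod T <= 2).
  { assert (Ez : (s * z)%C = ((s * x)%R, (s * Y)%R)).
    { unfold z, Cmult, Complex.RtoC; simpl; f_equal; ring. }
    assert (Hexp : 0 < cosh (s * Y) - sinh (s * Y) <= 1).
    { replace (cosh (s * Y) - sinh (s * Y)) with (exp (- (s * Y))) by (unfold cosh, sinh; field).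
      split; [apply exp_pos|]; rewrite <- exp_0; apply exp_nondecreasing.
      assert (0 <= s * Y) by (apply Rmult_le_pos; lra); lra. }
    eapply Rle_trans; [apply Cmod_le_abs|].
    replace (fst T) with (cos (s * x) * (cosh (s * Y) - sinh (s * Y))).
    2:{ unfold T; rewrite Ez; unfold Csin, Ccos, Re, Im; simpl; ring. }
    replace (snd T) with (sin (s * x) * (cosh (s * Y) - sinh (s * Y))).
    2:{ unfold T; rewrite Ez; unfold Csin, Ccos, Re, Im; simpl; ring. }
    rewrite !Rabs_mult, (Rabs_pos_eq (cosh (s * Y) - sinh (s * Y))) by lra.
    assert (Rabs (cos (s * x)) <= 1) by (apply Rabs_le, COS_bound).
    assert (Rabs (sin (s * x)) <= 1) by (apply Rabs_le, SIN_bound).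
    assert (P1 := Rabs_pos (cos (s * x))); assert (P2 := Rabs_pos (sin (s * x))).
    nra. }
  assert (EG : (f1 + (0, s) * f = (d * s / 2)%R * T - ((d * s / 2)%R * Ccos (d * z)
      + ((0, 1) * (s * s / 2)%R) * Csin (d * z)))%C).
  { unfold f1, f, char_chain, T; simpl sin_deriv; fold s d.
    generalize (Csin (s * z)%C : C) (Ccos (s * z)%C : C) (Csin (d * z)%C : C) (Ccos (d * z)%C : C).
    intros [a1 a2] [b1 b2] [c1 c2] [e1 e2].
    unfold Cminus, Cmult, Cplus, Copp, Complex.RtoC; simpl; f_equal; field. }
  rewrite EG; unfold Cminus; eapply Rle_trans; [apply Cmod_triangle|].
  rewrite Cmod_opp.
  assert (T1 := Cmod_triangle ((d * s / 2)%R * Ccos (d * z))%C ((0, 1) * (s * s / 2)%R * Csin (d * z))%C).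
  rewrite !Cmod_mult, !Cmod_R in *.
  change (Cmod (0, 1)) with (Cmod Ci) in T1; rewrite Cmod_Ci in T1.
  assert (Eds : Rabs (d * s / 2) = D * s / 2).
  { unfold D, Rdiv; rewrite !Rabs_mult, (Rabs_pos_eq s), (Rabs_pos_eq (/ 2)) by lra; reflexivity. }
  rewrite Eds in *; rewrite (Rabs_pos_eq (s * s / 2)) in T1 by nra.
  assert (0 < D * s) by (apply Rmult_lt_0_compat; lra).
  assert (D * s / 2 * Cmod T <= D * s / 2 * 2) by (apply Rmult_le_compat_l; lra).
  assert (D * s / 2 * Cmod (Ccos (d * z)%C) <= D * s / 2 * ch) by (apply Rmult_le_compat_l; lra).
  assert (1 * (s * s / 2) * Cmod (Csin (d * z)%C) <= 1 * (s * s / 2) * ch) by (apply Rmult_le_compat_l; nra).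
  assert (D * s * 1 <= D * s * ch) by (apply Rmult_le_compat_l; lra).
  assert (0 <= s * s * ch) by (apply Rmult_le_pos; nra).
  unfold K; nra.
Qed.

(* Writing [k] for the difference, [k < 1/8] forces [k^2 + 2 k <= 1/2], whereas [k^2 + 2 k] has
   mean value 1; [phi] below is an antiderivative of [k^2 + 2 k - 1/2]. *)
Lemma cos_difference_recurs (p q : R) :
  0 < p -> 0 < q -> p <> q ->
  exists B, 0 < B /\ forall X, exists x, X <= x <= X + B /\ 1 / 8 <= cos (p * x) - cos (q * x).
Proof.
  intros Hp Hq Hpq.
  set (c := / (4 * p) + / (4 * q) + / (p + q) + / Rabs (p - q) + 2 / p + 2 / q).
  assert (Hpq' : 0 < Rabs (p - q)) by (apply Rabs_pos_lt; lra).
  assert (I1 : 0 < / (4 * p)) by (apply Rinv_0_lt_compat; lra).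
  assert (I2 : 0 < / (4 * q)) by (apply Rinv_0_lt_compat; lra).
  assert (I3 : 0 < / (p + q)) by (apply Rinv_0_lt_compat; lra).
  assert (I4 : 0 < / Rabs (p - q)) by (apply Rinv_0_lt_compat; lra).
  assert (I5 : 0 < 2 / p) by (apply Rdiv_lt_0_compat; lra).
  assert (I6 : 0 < 2 / q) by (apply Rdiv_lt_0_compat; lra).
  (* [c] is the sum of the amplitudes in [osc]. Over this length [x / 2] grows by [2 c + 1 / 2]
     while [osc] drops by at most [2 c], so [phi] must increase strictly. *)
  exists (4 * c + 1); split; [unfold c; lra|]; intros X.
  apply NNPP; intros N.
  assert (Hk : forall x, X <= x <= X + (4 * c + 1) -> cos (p * x) - cos (q * x) < 1 / 8).
  { intros x Hx; apply Rnot_le_lt; intros h; apply N; exists x; auto. }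
  set (osc := fun x => sin (2 * p * x) * / (4 * p) + sin (2 * q * x) * / (4 * q)
     - sin ((p + q) * x) * / (p + q) - sin ((p - q) * x) * / (p - q)
     + sin (p * x) * (2 / p) - sin (q * x) * (2 / q)).
  assert (Hosc : forall x, Rabs (osc x) <= c).
  { intros x.
    assert (Bs : forall t r, Rabs (sin t * r) <= Rabs r).
    { intros t r; rewrite Rabs_mult; rewrite <- (Rmult_1_l (Rabs r)) at 2.
      apply Rmult_le_compat_r; [apply Rabs_pos|apply Rabs_le, SIN_bound]. }
    assert (S1 := Bs (2 * p * x) (/ (4 * p))); rewrite (Rabs_pos_eq (/ (4 * p))) in S1 by lra.
    assert (S2 := Bs (2 * q * x) (/ (4 * q))); rewrite (Rabs_pos_eq (/ (4 * q))) in S2 by lra.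
    assert (S3 := Bs ((p + q) * x) (/ (p + q))); rewrite (Rabs_pos_eq (/ (p + q))) in S3 by lra.
    assert (S4 := Bs ((p - q) * x) (/ (p - q))); rewrite (Rabs_inv (p - q)) in S4.
    assert (S5 := Bs (p * x) (2 / p)); rewrite (Rabs_pos_eq (2 / p)) in S5 by lra.
    assert (S6 := Bs (q * x) (2 / q)); rewrite (Rabs_pos_eq (2 / q)) in S6 by lra.
    apply Rabs_le; unfold osc, c.
    apply Rabs_le_between in S1; apply Rabs_le_between in S2; apply Rabs_le_between in S3.
    apply Rabs_le_between in S4; apply Rabs_le_between in S5; apply Rabs_le_between in S6; lra. }
  set (phi := fun x => x / 2 + osc x).
  set (k := fun x => cos (p * x) - cos (q * x)).
  assert (Hphi : forall x, is_derive phi x (k x ^ 2 + 2 * k x - 1 / 2)).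
  { intros x; unfold phi, osc, k; auto_derive; [trivial|].
    assert (Ep : cos (2 * p * x) = 2 * cos (p * x) * cos (p * x) - 1).
    { replace (2 * p * x) with (2 * (p * x)) by ring; apply cos_2a_cos. }
    assert (Eq : cos (2 * q * x) = 2 * cos (q * x) * cos (q * x) - 1).
    { replace (2 * q * x) with (2 * (q * x)) by ring; apply cos_2a_cos. }
    assert (Es : cos ((p + q) * x) = cos (p * x) * cos (q * x) - sin (p * x) * sin (q * x)).
    { rewrite Rmult_plus_distr_r; apply cos_plus. }
    assert (Em : cos ((p - q) * x) = cos (p * x) * cos (q * x) + sin (p * x) * sin (q * x)).
    { rewrite Rmult_minus_distr_r; apply cos_minus. }
    rewrite Ep, Eq, Es, Em; field; lra. }
  destruct (MVT_gen phi X (X + (4 * c + 1)) (fun x => k x ^ 2 + 2 * k x - 1 / 2)) as (xi & Hxi & E).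
  { intros x _; apply Hphi. }
  { intros x _; apply derivable_continuous_pt; eexists; apply is_derive_Reals, Hphi. }
  rewrite Rmin_left, Rmax_right in Hxi by (unfold c; lra).
  specialize (Hk xi Hxi); fold (k xi) in Hk.
  (* Needed when [k xi] is negative, where [k (k + 2) <= 0] holds only from [-2] on. *)
  assert (Bk : -2 <= k xi).
  { unfold k; assert (T1 := COS_bound (p * xi)); assert (T2 := COS_bound (q * xi)); lra. }
  assert (Hneg : k xi ^ 2 + 2 * k xi - 1 / 2 <= 0).
  { destruct (Rle_dec 0 (k xi)); nra. }
  assert (A1 := Hosc X); assert (A2 := Hosc (X + (4 * c + 1))).
  apply Rabs_le_between in A1; apply Rabs_le_between in A2.
  unfold phi in E.
  assert (Hc : 0 < c) by (unfold c; lra).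
  assert ((k xi ^ 2 + 2 * k xi - 1 / 2) * (X + (4 * c + 1) - X) <= 0) by nra.
  lra.
Qed.

(* [sin ((1 + gamma) x) * sin ((gamma - 1) x) = (cos (2 x) - cos (2 gamma x)) / 2], whose sign is
   controlled by the previous lemma. *)
Lemma char_good_abscissae (gamma : R) :
  gamma > 0 -> gamma <> 1 ->
  exists B delta, 0 < B /\ 0 < delta /\ forall X, exists x, X <= x <= X + B /\
    forall y, delta <= Rabs (fst (char_chain gamma 0 (x, y))).
Proof.
  intros Hg Hg1.
  assert (Efst : forall x y, fst (char_chain gamma 0 (x, y)) =
    (gamma - 1) / 2 * (sin ((1 + gamma) * x) * cosh ((1 + gamma) * y))
    - (1 + gamma) / 2 * (sin ((gamma - 1) * x) * cosh ((gamma - 1) * y))).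
  { intros x y; unfold char_chain; simpl sin_deriv.
    assert (E : forall a : R, (a * (x, y))%C = ((a * x)%R, (a * y)%R)).
    { intros; unfold Cmult, Complex.RtoC; simpl; f_equal; ring. }
    rewrite !E; unfold Csin, Re, Im; simpl; ring. }
  assert (Eprod : forall x, sin ((1 + gamma) * x) * sin ((gamma - 1) * x)
                     = (cos (2 * x) - cos (2 * gamma * x)) / 2).
  { intros x.
    replace (2 * x) with ((1 + gamma) * x - (gamma - 1) * x) by ring.
    replace (2 * gamma * x) with ((1 + gamma) * x + (gamma - 1) * x) by ring.
    rewrite cos_minus, cos_plus; field. }
  (* Opposite signs make the two terms add up, and [|v| <= 1] forces [|u| >= 1 / 16]. The factors
     [c1], [c2] will be values of [cosh]; being at least 1 they only help, so the bound is uniform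
     in [y]. *)
  assert (Hb : forall u v c1 c2 e1 e2, 0 < e1 -> 0 < e2 -> u * v <= - (1 / 16) -> -1 <= u <= 1 -> -1 <= v <= 1 ->
     1 <= c1 -> 1 <= c2 -> e1 / 16 <= Rabs (e1 * (u * c1) - e2 * (v * c2))).
  { intros u v c1 c2 e1 e2 He1 He2 Huv Hu Hv Hc1 Hc2.
    destruct (Rle_dec 0 u) as [h|h].
    - assert (1 / 16 <= u) by nra. assert (v <= 0) by nra.
      assert (1 / 16 <= u * c1) by nra. assert (v * c2 <= 0) by nra.
      eapply Rle_trans; [|apply Rle_abs]. nra.
    - assert (u <= - (1 / 16)) by nra. assert (0 <= v) by nra.
      assert (u * c1 <= - (1 / 16)) by nra. assert (0 <= v * c2) by nra.
      rewrite <- Rabs_Ropp; eapply Rle_trans; [|apply Rle_abs]. nra. }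
  (* The sign of [gamma - 1] decides which sign of the product of sines is favourable. For
     [gamma < 1] the two frequencies are exchanged and the first sine is negated. The bound 1/8
     becomes 1/16 through the half in [Eprod]. *)
  destruct (Rlt_dec 1 gamma) as [h|h].
  - destruct (cos_difference_recurs (2 * gamma) 2) as (B & HB & H); [lra..|].
    exists B, ((gamma - 1) / 2 / 16); split; [exact HB|split; [lra|]]; intros X.
    destruct (H X) as (x & Hx & Hk); exists x; split; [exact Hx|]; intros y.
    rewrite Efst; apply Hb; try lra; try apply SIN_bound; try apply cosh_ge_1.
    rewrite Eprod; lra.
  - destruct (cos_difference_recurs 2 (2 * gamma)) as (B & HB & H); [lra..|].
    exists B, ((1 - gamma) / 2 / 16); split; [exact HB|split; [lra|]]; intros X.
    destruct (H X) as (x & Hx & Hk); exists x; split; [exact Hx|]; intros y.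
    rewrite Efst.
    replace ((gamma - 1) / 2 * (sin ((1 + gamma) * x) * cosh ((1 + gamma) * y))
      - (1 + gamma) / 2 * (sin ((gamma - 1) * x) * cosh ((gamma - 1) * y))) with
      ((1 - gamma) / 2 * ((- sin ((1 + gamma) * x)) * cosh ((1 + gamma) * y))
      - (1 + gamma) / 2 * (sin ((gamma - 1) * x) * cosh ((gamma - 1) * y))) by field.
    assert (T := SIN_bound ((1 + gamma) * x)).
    apply Hb; try lra; try apply SIN_bound; try apply cosh_ge_1.
    rewrite <- Ropp_mult_distr_l, Eprod; lra.
Qed.

(** * Counting *)

Lemma exact_enumeration (P : C -> Prop) :
  (exists l, forall z, P z -> In z l) -> exists l, NoDup l /\ forall z, In z l <-> P z.
Proof.
  intros [l Hl].
  set (dec := fun x y : C => excluded_middle_informative (x = y)).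
  set (p := fun z => if excluded_middle_informative (P z) then true else false).
  exists (nodup dec (filter p l)); split; [apply NoDup_nodup|].
  intros z; rewrite nodup_In, filter_In; unfold p.
  destruct (excluded_middle_informative (P z)) as [h|h].
  - split; [intros _; exact h|intros _; split; auto].
  - split; [intros [_ e]; discriminate e|intros h'; contradiction].
Qed.

Lemma total_multiplicity_app (mu : C -> nat) (l1 l2 : list C) :
  total_multiplicity mu (l1 ++ l2) = (total_multiplicity mu l1 + total_multiplicity mu l2)%nat.
Proof.
  unfold total_multiplicity; induction l1 as [|a l1 IH]; simpl; [reflexivity|rewrite IH; lia].
Qed.

Lemma total_multiplicity_incl (mu : C -> nat) (l l' : list C) :
  NoDup l -> incl l l' -> (total_multiplicity mu l <= total_multiplicity mu l')%nat.
Proof.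
  revert l'; induction l as [|a l IH]; intros l' Hl Hi; [apply Nat.le_0_l|].
  destruct (in_split a l') as (l1 & l2 & ->); [apply Hi; left; reflexivity|].
  inversion Hl as [|? ? Ha Hl']; subst.
  assert (T := IH (l1 ++ l2) Hl').
  rewrite total_multiplicity_app in T |- *.
  unfold total_multiplicity in *; simpl.
  assert (incl l (l1 ++ l2)).
  { intros x Hx; assert (Hx' : In x (l1 ++ a :: l2)) by (apply Hi; right; exact Hx).
    apply in_app_or in Hx'; apply in_or_app.
    destruct Hx' as [h|[h|h]]; [left; exact h|subst; contradiction|right; exact h]. }
  specialize (T H); lia.
Qed.

(** Choice gathers the orders and constant terms of the individual zeros into functions, so that one
    pair [mu], [c] serves every rectangle. *)
Lemma char_zero_data (gamma : R) :
  gamma > 0 -> gamma <> 1 ->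
  exists (mu : C -> nat) (c : C -> C), forall z, char_chain gamma 0 z = 0%C ->
    zero_order (Fchar gamma) z (mu z) /\
    log_derivative_residue (char_chain gamma 0) (char_chain gamma 1) z (mu z) (c z).
Proof.
  intros Hg Hg1.
  assert (H : forall z, exists mc : nat * C, char_chain gamma 0 z = 0%C ->
    zero_order (Fchar gamma) z (fst mc) /\
    log_derivative_residue (char_chain gamma 0) (char_chain gamma 1) z (fst mc) (snd mc)).
  { intros z; destruct (classic (char_chain gamma 0 z = 0%C)) as [e|n].
    - destruct (zero_multiplicity_exists (char_chain gamma) z) as (m & c & Ho & Hr);
        [apply derivative_chain_char|apply char_chain_nonvanishing; assumption|exact e|].
      exists (m, c); intros _; split; [|exact Hr].
      destruct Ho as (E0 & L & HL & H); split; [rewrite Fchar_char_chain; exact E0|].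
      exists L; split; [exact HL|]; intros eps He; destruct (H eps He) as (d & Hd & Hb).
      exists d; split; [exact Hd|]; intros w Hw; rewrite Fchar_char_chain; apply Hb; exact Hw.
    (* A dummy value off the zeros, where nothing is claimed. *)
    - exists (0%nat, Complex.RtoC 0); intros e; contradiction. }
  exists (fun z => fst (proj1_sig (constructive_indefinite_description _ (H z)))),
         (fun z => snd (proj1_sig (constructive_indefinite_description _ (H z)))).
  intros z; apply (proj2_sig (constructive_indefinite_description _ (H z))).
Qed.

Lemma char_zeros_enumeration (gamma a b : R) :
  gamma > 0 -> gamma <> 1 ->
  exists l, NoDup l /\ forall z : C, In z l <-> (char_chain gamma 0 z = 0%C /\ a < fst z < b).
Proof.
  intros Hg Hg1; apply exact_enumeration.
  destruct (char_chain_zeros_in_strip gamma Hg Hg1) as (Cg & HCg & Hs).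
  destruct (finitely_many_isolated (fun z => char_chain gamma 0 z = 0%C) a b (- Cg) Cg) as [l Hl].
  - intros z; apply isolated_of_chain; [apply derivative_chain_char|apply char_chain_nonvanishing; assumption].
  - exists l; intros z [Hz Hab]; apply Hl; [lra| |exact Hz].
    apply Rabs_le_between, Hs; exact Hz.
Qed.

(** The point is the order of the quantifiers: [K] depends on [E] and [delta] but not on [a] and
    [b], so it stays fixed while the rectangle grows with [r]. *)
Lemma char_count_between (gamma delta E : R) (mu : C -> nat) (c : C -> C) :
  gamma > 0 -> gamma <> 1 -> 0 < delta -> 0 < E ->
  (forall z, char_chain gamma 0 z = 0%C ->
     log_derivative_residue (char_chain gamma 0) (char_chain gamma 1) z (mu z) (c z)) ->
  exists K, 0 <= K /\ forall a b l, a < b ->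
    (forall y, delta <= Rabs (fst (char_chain gamma 0 (a, y)))) ->
    (forall y, delta <= Rabs (fst (char_chain gamma 0 (b, y)))) ->
    NoDup l -> (forall z, In z l <-> (char_chain gamma 0 z = 0%C /\ a < fst z < b)) ->
    Rabs (2 * PI * INR (total_multiplicity mu l) - 2 * (1 + gamma) * (b - a)) <= E * (b - a) + K.
Proof.
  intros Hg Hg1 Hdelta HE Hres.
  destruct (char_chain_zeros_in_strip gamma Hg Hg1) as (Cg & HCg & Hs).
  destruct (char_log_derivative_top gamma (E / 2) Hg Hg1) as (Y0 & HY0 & Htop); [lra|].
  (* High enough for the estimate of [F'/F] and, as [Y0 > 0], strictly above every zero. *)
  set (Y := Y0 + Cg).
  set (s := 1 + gamma); set (d := gamma - 1).
  (* Bounds [|F'|] up to height [Y]; on a good line [|F| >= delta], hence [|F'/F| <= A / delta] on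
     the vertical sides. *)
  set (A := Rabs (d / 2 * s) * (cosh (s * Y) + cosh (d * Y))).
  assert (HA : 0 <= A).
  { apply Rmult_le_pos; [apply Rabs_pos|].
    assert (T1 := cosh_ge_1 (s * Y)); assert (T2 := cosh_ge_1 (d * Y)); lra. }
  assert (Hcosh : forall a u, Rabs u <= Y -> cosh (a * u) <= cosh (a * Y)).
  { intros a u Hu; apply cosh_le_abs.
    rewrite !Rabs_mult, (Rabs_pos_eq Y) by (unfold Y; lra).
    apply Rmult_le_compat_l; [apply Rabs_pos|exact Hu]. }
  assert (Hf1 : forall z : C, Rabs (snd z) <= Y -> Cmod (char_chain gamma 1 z) <= A).
  { intros z Hz; unfold char_chain; fold s d; simpl sin_deriv.
    unfold Cminus; eapply Rle_trans; [apply Cmod_triangle|].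
    rewrite Cmod_opp, !Cmod_mult, !Cmod_R.
    replace (s / 2 * d ^ 1) with (d / 2 * s) by field; rewrite pow_1.
    destruct (Csin_Ccos_bounds (s * z)%C) as (_ & B1 & _).
    destruct (Csin_Ccos_bounds (d * z)%C) as (_ & B2 & _).
    rewrite snd_real_mult in B1, B2.
    rewrite <- Rmult_plus_distr_l; apply Rmult_le_compat_l; [apply Rabs_pos|].
    assert (T1 := Hcosh s (snd z) Hz); assert (T2 := Hcosh d (snd z) Hz); lra. }
  assert (Hvert : forall x y, (forall y, delta <= Rabs (fst (char_chain gamma 0 (x, y)))) ->
     - Y <= y <= Y -> Rabs (fst (char_chain gamma 1 (x, y) / char_chain gamma 0 (x, y))%C) <= A / delta).
  { intros x y Hx Hy; specialize (Hx y).
    assert (T := abs_fst_le_Cmod (char_chain gamma 0 (x, y))).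
    assert (T0 : 0 < Cmod (char_chain gamma 0 (x, y))) by lra.
    eapply Rle_trans; [apply abs_fst_le_Cmod|].
    rewrite Cmod_div by (apply Cmod_pos_neq; exact T0).
    apply Rle_div_l; [exact T0|].
    apply Rle_trans with A; [apply Hf1; apply Rabs_le; exact Hy|].
    replace A with (A / delta * delta) at 1 by (field; lra).
    apply Rmult_le_compat_l; [|lra]. apply Rdiv_le_0_compat; lra. }
  exists (4 * Y * (A / delta)); split.
  { apply Rmult_le_pos; [unfold Y; lra|apply Rdiv_le_0_compat; lra]. }
  intros a b l Hab Ha Hb Hl Hin.
  assert (Hnz : forall x, (forall y, delta <= Rabs (fst (char_chain gamma 0 (x, y)))) ->
     forall y, char_chain gamma 0 (x, y) <> 0%C).
  { intros x Hx y e; specialize (Hx y); rewrite e in Hx; simpl in Hx; rewrite Rabs_R0 in Hx; lra. }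
  apply (argument_principle_estimate (char_chain gamma 0) (char_chain gamma 1) (char_chain gamma 2)
           l mu c a b Y (2 * s) E (A / delta)); try assumption.
  - unfold Y; lra.
  - lra.
  - intros z; split; apply derivative_chain_char.
  - intros z; split; [|split]; apply derivative_chain_char.
  - intros zeta Hi; apply Hin in Hi; destruct Hi as [Hz Hz'].
    assert (T := Hs zeta Hz); apply Rabs_le_between in T.
    repeat split; try assumption; try lra; try (unfold Y; lra).
    apply Hres; exact Hz.
  - intros [u v] Hz e; apply Hin; split; [exact e|]; simpl in Hz |- *.
    split.
    + destruct (proj1 Hz) as [h|h]; [exact h|subst; exfalso; apply (Hnz u Ha v e)].
    + destruct (proj2 Hz) as [h|h]; [exact h|subst; exfalso; apply (Hnz b Hb v e)].
  - intros x Hx.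
    (* Conjugation gives the bottom side from the top one. The two sides contribute equally, which
       is why the top estimate was taken with [E / 2]. *)
    assert (Econj : forall k, char_chain gamma k (x, (- Y)%R) = Complex.Cconj (char_chain gamma k (x, Y))).
    { intros k; rewrite <- char_chain_conj; reflexivity. }
    rewrite !Econj, snd_div_conj.
    assert (T := Htop x Y ltac:(unfold Y; lra)); fold s in T.
    set (q := snd (char_chain gamma 1 (x, Y) / char_chain gamma 0 (x, Y))%C) in *.
    replace (- q - q - 2 * s) with (-2 * (q + s)) by ring.
    rewrite Rabs_mult, (Rabs_left (-2)) by lra; lra.
  - intros y Hy; split; apply Hvert; assumption.
Qed.

Theorem theorem4 (gamma : R) (hg : gamma > 0) (hg1 : gamma <> 1) :
  (forall l : Cx, is_ITE gamma l -> is_ITE gamma (Cconj l)) /\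
  (exists Cg : R, Cg > 0 /\ forall l : Cx, is_ITE gamma l -> Rabs (Im l) <= Cg) /\
  (forall r : R, r > 0 -> exists n : nat, N_alg_is gamma r n) /\
  (forall eps : R, eps > 0 -> exists R0 : R, forall r : R, r >= R0 ->
     forall n : nat, N_alg_is gamma r n ->
       Rabs (INR n - (1 + gamma) * r / PI) <= eps * r).
Proof.
  destruct (char_chain_zeros_in_strip gamma hg hg1) as (Cg & HCg & Hs).
  destruct (char_zero_data gamma hg hg1) as (mu & c & Hmu).
  assert (Hregion : forall r (z : C), in_count_region gamma r z <->
    (char_chain gamma 0 z = 0%C /\ 0 < fst z /\ Cmod z <= r)).
  { intros r z; unfold in_count_region, is_ITE, Re.
    rewrite Fchar_char_chain, Cnorm_Cmod; split.
    - intros ((_ & H1) & H2 & H3); auto.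
    - intros (H1 & H2 & H3); split; [split; [|exact H1]|split; [exact H2|exact H3]].
      intros e; rewrite e in H2; simpl in H2; lra. }
  split; [|split; [|split]].
  - intros l [H1 H2]; split.
    + intros e; apply H1; destruct l as [x y]; injection e; intros e1 e2.
      unfold Re, Im in *; simpl in *; unfold Cx0; f_equal; lra.
    + rewrite Fchar_char_chain in *.
      change (char_chain gamma 0 (Complex.Cconj l) = 0%C).
      rewrite char_chain_conj, H2; unfold Complex.Cconj; simpl; rewrite Ropp_0; reflexivity.
  - exists Cg; split; [exact HCg|]; intros l [_ H]; apply Hs.
    rewrite <- Fchar_char_chain; exact H.
  - intros r Hr.
    destruct (char_zeros_enumeration gamma 0 (r + 1) hg hg1) as (l0 & _ & Hl0).
    destruct (exact_enumeration (in_count_region gamma r)) as (l & Hl & Hin).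
    { exists l0; intros z Hz; apply Hregion in Hz; destruct Hz as (H1 & H2 & H3).
      apply Hl0; split; [exact H1|].
      assert (T := abs_fst_le_Cmod z); assert (T' := Rle_abs (fst z)); lra. }
    exists (total_multiplicity mu l), (map (fun z : Cx => (z, mu z)) l).
    assert (E : map (fst (A := Cx) (B := nat)) (map (fun z : Cx => (z, mu z)) l) = l).
    { rewrite map_map; apply map_id. }
    split; [|split; [|split]].
    + rewrite E; exact Hl.
    + intros z; rewrite E; symmetry; apply Hin.
    + intros p Hp; apply in_map_iff in Hp; destruct Hp as (z & <- & Hz); simpl.
      apply Hmu; apply Hin, Hregion in Hz; apply Hz.
    + rewrite map_map; reflexivity.
  - intros eps Heps.
    destruct (char_good_abscissae gamma hg hg1) as (B & delta & HB & Hdelta & Hgood).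
    destruct (char_count_between gamma delta eps mu c hg hg1 Hdelta Heps) as (K & HK & Hcount).
    { intros z Hz; apply Hmu; exact Hz. }
    (* The imaginary axis passes through the zero of [F] at 0, so the rectangles start at a fixed
       good line instead; the zeros with [0 < Re z < a] contribute the constant [N0]. *)
    destruct (Hgood 1) as (a & Ha & Hla).
    destruct (char_zeros_enumeration gamma 0 a hg hg1) as (l0 & Hl0 & Hin0).
    set (N0 := INR (total_multiplicity mu l0)).
    set (s := 1 + gamma).
    assert (Hpi := PI_RGT_0); assert (Hpi1 := PI2_1).
    set (W := B + Cg + 1 + a).
    set (K' := K + 2 * PI * N0 + (2 * s + eps) * W).
    assert (HN0 : 0 <= N0) by apply pos_INR.
    assert (HW : 0 < W) by (unfold W; lra).
    assert (HsW : 0 < (2 * s + eps) * W) by (apply Rmult_lt_0_compat; unfold s; lra).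
    assert (HpN : 0 <= 2 * PI * N0) by (apply Rmult_le_pos; lra).
    (* The first bound keeps both right sides beyond [a]; the second makes all constants collected
       in [K'] at most [eps * r]. *)
    exists (Rmax (W + 1) (K' / eps)); intros r Hr n (L & HL & HLin & HLord & HLsum).
    assert (R1 := Rmax_l (W + 1) (K' / eps)); assert (R2 := Rmax_r (W + 1) (K' / eps)).
    assert (HrW : W + 1 <= r) by lra.
    assert (HrK : K' <= eps * r).
    { replace K' with (eps * (K' / eps)) by (field; lra). apply Rmult_le_compat_l; lra. }
    assert (En : n = total_multiplicity mu (map fst L)).
    { rewrite <- HLsum; unfold total_multiplicity; rewrite map_map; f_equal.
      apply map_ext_in; intros p Hp.
      apply (zero_order_unique (Fchar gamma) (fst p)); [apply HLord; exact Hp|].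
      apply Hmu. apply (Hregion r), HLin, in_map; exact Hp. }
    assert (Hin : forall z : C, In z (map fst L) <->
      (char_chain gamma 0 z = 0%C /\ 0 < fst z /\ Cmod z <= r)).
    { intros z; rewrite <- Hregion; symmetry; apply HLin. }
    (* Since [b1 + Cg < r], zeros of the strip between [a] and [b1] lie in the disc; the line
       [b2 >= r + 1] has the whole disc on its left. Both are within [W] of the required place. *)
    destruct (Hgood (r - B - Cg - 1)) as (b1 & Hb1 & Hl1).
    destruct (Hgood (r + 1)) as (b2 & Hb2 & Hl2).
    unfold W in HrW.
    destruct (char_zeros_enumeration gamma a b1 hg hg1) as (l1 & Hn1 & Hin1).
    destruct (char_zeros_enumeration gamma a b2 hg hg1) as (l2 & Hn2 & Hin2).
    assert (C1 := Hcount a b1 l1 ltac:(lra) Hla Hl1 Hn1 Hin1).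
    assert (C2 := Hcount a b2 l2 ltac:(lra) Hla Hl2 Hn2 Hin2).
    assert (Low : (total_multiplicity mu l1 <= n)%nat).
    { rewrite En; apply total_multiplicity_incl; [exact Hn1|].
      intros z Hz; apply Hin1 in Hz; destruct Hz as [Hz Hz']; apply Hin.
      split; [exact Hz|split; [lra|]].
      assert (T := Hs z Hz); eapply Rle_trans; [apply Cmod_le_abs|].
      rewrite (Rabs_pos_eq (fst z)) by lra; lra. }
    assert (Up : (n <= total_multiplicity mu l0 + total_multiplicity mu l2)%nat).
    { rewrite En, <- total_multiplicity_app; apply total_multiplicity_incl; [exact HL|].
      intros z Hz; apply Hin in Hz; destruct Hz as (Hz & H0 & Hr'); apply in_or_app.
      assert (T := abs_fst_le_Cmod z); assert (T' := Rle_abs (fst z)).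
      destruct (Rtotal_order (fst z) a) as [h|[h|h]].
      - left; apply Hin0; split; [exact Hz|lra].
      - exfalso; specialize (Hla (snd z)); rewrite <- h in Hla.
        replace (fst z, snd z) with z in Hla by (destruct z; reflexivity).
        rewrite Hz in Hla; simpl in Hla; rewrite Rabs_R0 in Hla; lra.
      - right; apply Hin2; split; [exact Hz|lra]. }
    apply le_INR in Low; apply le_INR in Up; rewrite plus_INR in Up; fold N0 in Up.
    apply Rabs_le_between in C1; apply Rabs_le_between in C2; fold s in C1, C2.
    set (n1 := INR (total_multiplicity mu l1)) in *; set (n2 := INR (total_multiplicity mu l2)) in *.
    assert (M1 : 2 * PI * n1 <= 2 * PI * INR n) by (apply Rmult_le_compat_l; lra).
    assert (M2 : 2 * PI * INR n <= 2 * PI * (N0 + n2)) by (apply Rmult_le_compat_l; lra).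
    assert (Hs0 : 0 < s) by (unfold s; lra).
    assert (G1 : 2 * s * (r - W) <= 2 * s * (b1 - a)) by (apply Rmult_le_compat_l; unfold W; lra).
    assert (G2 : eps * (b1 - a) <= eps * r) by (apply Rmult_le_compat_l; lra).
    assert (G3 : (2 * s + eps) * (b2 - a) <= (2 * s + eps) * (r + W)).
    { apply Rmult_le_compat_l; [lra|unfold W; lra]. }
    assert (He0 : 0 < eps * W) by (apply Rmult_lt_0_compat; lra).
    (* One [eps * r] comes from the horizontal sides and one from [K']; division by [2 * PI > 2]
       brings the sum below [eps * r]. *)
    assert (Fin : Rabs (2 * PI * INR n - 2 * s * r) <= 2 * (eps * r)).
    { apply Rabs_le; unfold K' in HrK; lra. }
    replace (INR n - s * r / PI) with ((2 * PI * INR n - 2 * s * r) * / (2 * PI)) by (field; lra).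
    rewrite Rabs_mult, (Rabs_pos_eq (/ (2 * PI))) by (left; apply Rinv_0_lt_compat; lra).
    apply Rle_div_l; [lra|].
    assert (0 < eps * r) by (apply Rmult_lt_0_compat; lra).
    nra.
Qed.
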